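(* Let $\Omega$ be a finite state space with $d=|\Omega|$, and let $P=[p(u,v)]_{u,v\in\Omega}$ be an irreducible reversible transition matrix on $\Omega$ with invariant distribution $\mu$. Let $\nu$ be a probability distribution on $\Omega$, and for $n\in\mathbb{N}_+$ let $H_n$ be the Symmetric Counting Estimator built from $P$ and $\nu$ (see context). Then there exist absolute constants $C_1,C_2>0$ (independent of $\Omega,d,P,\nu,n,t$) such that for every $n\in\mathbb{N}_+$ and every $t>0$, $$\mathbb{P}\left\{\|H_n-D_\mu P\|\ge t\right\}\le C_1\,d^{\,2-\pi/4}\,\|\nu/\mu\|_\infty\exp\left(-C_2\,\eta(P)\,n\,t^2\right),$$ where $\|\cdot\|$ is the $\ell_2$ operator norm and $\eta(P)$ is the spectral gap of $P$.
   Context: $d\ge 2$. Reversible means $\mu(u)p(u,v)=\mu(v)p(v,u)$ for all $u,v$. $D_\mu$ is the diagonal matrix with diagonal $\mu$. $\|\nu/\mu\|_\infty=\max_u\nu(u)/\mu(u)$. $P$ acts on functions by $Ph(u)=\sum_v p(u,v)h(v)$. With $\langle f,g\rangle_\mu=\sum_u\mu(u)f(u)g(u)$, $\|\cdot\|_\mu$ the associated norm, and $L^0_{2,\mu}=\{h:\Omega\to\mathbb{R}:\sum_u\mu(u)h(u)=0\}$, the spectral gap is $\eta(P)=1-\sup_{0\ne h\in L^0_{2,\mu}}\langle h,Ph\rangle_\mu/\|h\|_\mu^2$. Symmetric Counting Estimator: let $\tilde\Omega^2$ be the quotient of $\Omega^2$ by $(u_1,u_2)\sim(u_2,u_1)$,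 with classes written $\widetilde{(u_1,u_2)}$. Let $\{\tilde{u}_k\}_{k\ge1}$ be the Markov chain on $\tilde\Omega^2$ whose initial state is $\tilde u_1=\widetilde{(u,v)}$ with $u\sim\nu$ and then $v\sim p(u,\cdot)$, and whose transitions are: from $\widetilde{(u_1,u_2)}$, choose $(w_1,w_2)$ to be $(u_1,u_2)$ or $(u_2,u_1)$ with probability $1/2$ each, then draw $v$ with probability $p(w_2,v)$ and jump to $\widetilde{(w_2,v)}$. Let $\tilde F(\widetilde{(w_1,w_2)})=\frac12(E_{w_1w_2}+E_{w_2w_1})$, where $E_{uv}$ is the $\Omega\times\Omega$ matrix with entry $1$ at $(u,v)$ and $0$ elsewhere. Then $H_n=\frac1n\sum_{k=1}^n\tilde F(\tilde u_k)$. *)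

(* Defs.v *)
From HB Require Import structures.
From mathcomp Require Import all_boot all_order all_algebra generic_quotient.
From mathcomp Require Import all_classical all_reals all_analysis.

Set Implicit Arguments.
Unset Strict Implicit.
Unset Printing Implicit Defensive.

Import Order.TTheory GRing.Theory Num.Theory.

Local Open Scope classical_set_scope.
Local Open Scope quotient_scope.
Local Open Scope ring_scope.

Section OperatorNorm.
Variables (R : realType) (m n : nat).

Definition l2norm k (x : 'cV[R]_k) : R := Num.sqrt (\sum_i x i 0 ^+ 2).

Definition opnorm (A : 'M[R]_(m, n)) : R :=
  sup [set l2norm (A *m x) | x in [set x : 'cV[R]_n | l2norm x <= 1]].

End OperatorNorm.

Section Kernels.
Variables (R : realType) (Omega : finType).
Implicit Types (p : Omega -> Omega -> R) (mu nu h f g : Omega -> R).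

(* Omega x Omega matrices are library matrices indexed by 'I_#|Omega|, through
   the bijection enum_rank / enum_val between Omega and 'I_#|Omega|. *)
Definition kernel_mx p : 'M[R]_#|Omega| :=
  \matrix_(i, j) p (enum_val i) (enum_val j).

Definition D_mx mu : 'M[R]_#|Omega| := diag_mx (\row_i mu (enum_val i)).

Definition E_mx (u v : Omega) : 'M[R]_#|Omega| :=
  delta_mx (enum_rank u) (enum_rank v).

Definition is_distribution mu : Prop :=
  (forall u, 0 <= mu u) /\ \sum_u mu u = 1.

Definition is_transition p : Prop := forall u, is_distribution (p u).

Definition is_irreducible p : Prop :=
  forall u v, exists k : nat,
    0 < (kernel_mx p ^+ k : 'M[R]_#|Omega|) (enum_rank u) (enum_rank v).

Definition is_invariant p mu : Prop :=
  forall v, \sum_u mu u * p u v = mu v.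

Definition is_reversible p mu : Prop :=
  forall u v, mu u * p u v = mu v * p v u.

Definition kernel_act p h : Omega -> R := fun u => \sum_v p u v * h v.

Definition inner mu f g : R := \sum_u mu u * f u * g u.

Definition spectral_gap p mu : R :=
  1 - sup [set inner mu h (kernel_act p h) / inner mu h h |
           h in [set h : Omega -> R | (exists u, h u != 0) /\
                                      \sum_u mu u * h u = 0]].

(* The default value 0 of the iterated maximum is harmless: the ratios are
   nonnegative for distributions nu and mu. *)
Definition ratio_sup nu mu : R := \big[Num.max/0]_(u : Omega) (nu u / mu u).

End Kernels.

Section UnorderedPairs.
Variable Omega : finType.

Definition pair_swap_eq : rel (Omega * Omega) :=
  fun a b => (a == b) || (a == (b.2, b.1)).

Lemma pair_swap_eqP a b :
  reflect (a = b \/ a = (b.2, b.1)) (pair_swap_eq a b).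
Proof.
apply: (iffP orP) => -[ab|ab]; [left|right|left|right]; exact/eqP.
Qed.

Lemma pair_swap_eq_refl : reflexive pair_swap_eq.
Proof. by move=> a; rewrite /pair_swap_eq eqxx. Qed.

Lemma pair_swap_eq_sym : symmetric pair_swap_eq.
Proof.
by move=> [a b] [c d]; apply/pair_swap_eqP/pair_swap_eqP => /= -[] [-> ->]; auto.
Qed.

Lemma pair_swap_eq_trans : transitive pair_swap_eq.
Proof.
move=> b a c /pair_swap_eqP ab /pair_swap_eqP bc; apply/pair_swap_eqP.
case: a b c ab bc => [a1 a2] [b1 b2] [c1 c2] /=.
by move=> [[-> ->]|[-> ->]] [[-> ->]|[-> ->]]; auto.
Qed.

Canonical pair_swap_equiv :=
  EquivRel pair_swap_eq pair_swap_eq_refl pair_swap_eq_sym pair_swap_eq_trans.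

Definition sym_pair := {eq_quot pair_swap_equiv}.

HB.instance Definition _ := [Finite of sym_pair by <:%/].

Definition sym_class (u v : Omega) : sym_pair := \pi_sym_pair (u, v).

Lemma sym_classC u v : sym_class u v = sym_class v u.
Proof. by apply/eqmodP/pair_swap_eqP; right. Qed.

Lemma repr_sym_class u v :
  repr (sym_class u v) = (u, v) \/ repr (sym_class u v) = (v, u).
Proof.
apply/pair_swap_eqP.
have /eqmodP : \pi_sym_pair (repr (sym_class u v)) = \pi_sym_pair (u, v).
  by rewrite reprK.
by [].
Qed.

End UnorderedPairs.

Section SymmetricChain.
Variables (R : realType) (Omega : finType).
Implicit Types (p : Omega -> Omega -> R) (nu : Omega -> R).

Definition sym_init nu p (a : sym_pair Omega) : R :=
  \sum_u \sum_(v | sym_class u v == a) nu u * p u v.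

(* Probability of jumping to the class a when v is drawn from p w and the next
   state is the class of (w, v). *)
Definition sym_jump p (w : Omega) (a : sym_pair Omega) : R :=
  \sum_(v | sym_class w v == a) p w v.

(* The two orderings of the current pair are equally likely, and w_2 is the
   second component of the chosen ordering. *)
Definition sym_trans p (a b : sym_pair Omega) : R :=
  2^-1 * sym_jump p (repr a).2 b + 2^-1 * sym_jump p (repr a).1 b.

Definition F_sym (a : sym_pair Omega) : 'M[R]_#|Omega| :=
  2^-1 *: (E_mx R (repr a).1 (repr a).2 + E_mx R (repr a).2 (repr a).1).

(* Neither definition depends on the representatives. *)
Lemma sym_trans_class p u v b :
  sym_trans p (sym_class u v) b =
  2^-1 * sym_jump p v b + 2^-1 * sym_jump p u b.
Proof.
by rewrite /sym_trans; case: (repr_sym_class u v) => -> //=; rewrite addrC.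
Qed.

Lemma F_sym_class u v :
  F_sym (sym_class u v) = 2^-1 *: (E_mx R u v + E_mx R v u).
Proof.
by rewrite /F_sym; case: (repr_sym_class u v) => -> //=; rewrite addrC.
Qed.

Lemma sym_trans_distribution p a :
  is_transition p -> is_distribution (sym_trans p a).
Proof.
move=> tp; have jump_ge0 w b : 0 <= sym_jump p w b.
  by apply: sumr_ge0 => v _; exact: (tp w).1.
have jump_sum w : \sum_b sym_jump p w b = 1.
  by rewrite -(tp w).2 [RHS](partition_big (sym_class w) xpredT).
split=> [b|]; first by rewrite addr_ge0// mulr_ge0// invr_ge0.
by rewrite big_split/= -!mulr_sumr !jump_sum !mulr1 -[2^-1]mul1r -splitr.
Qed.

Lemma sym_init_distribution nu p :
  is_distribution nu -> is_transition p -> is_distribution (sym_init nu p).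
Proof.
move=> [nu0 nu1] tp; split=> [a|].
  by do 2!apply: sumr_ge0 => ? _; rewrite mulr_ge0//; exact: (tp _).1.
rewrite exchange_big -nu1; apply: eq_bigr => u _ /=.
rewrite -[RHS]mulr1 -(tp u).2 mulr_sumr.
by rewrite [RHS](partition_big (sym_class u) xpredT).
Qed.

End SymmetricChain.

Section MarkovChain.
Variables (R : realType) (d : measure_display) (T : measurableType d).
Variables (Pr : probability T R) (S : finType).

(* Time starts at 0.  The Markov property with transition probabilities q is
   multiplied out, so that it is also meaningful for past trajectories of
   probability zero. *)
Definition is_markov_chain (init : S -> R) (q : S -> S -> R)
    (X : nat -> T -> S) : Prop :=
  [/\ forall k x, measurable [set w | X k w = x],
      forall x, Pr [set w | X 0%N w = x] = (init x)%:E &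
      forall (n : nat) (x : nat -> S),
        Pr [set w | forall k, (k <= n.+1)%N -> X k w = x k] =
        (Pr [set w | forall k, (k <= n)%N -> X k w = x k]
          * (q (x n) (x n.+1))%:E)%E].

End MarkovChain.

(* X k is the state of the chain that is usually numbered k + 1. *)
Definition sym_counting (R : realType) (Omega : finType) (T : Type)
    (X : nat -> T -> sym_pair Omega) (n : nat) (w : T) : 'M[R]_#|Omega| :=
  n%:R^-1 *: \sum_(k < n) F_sym R (X k w).

(* Main.v *)
From HB Require Import structures.
Require Import Defs.
From mathcomp Require Import all_boot all_order all_algebra.
From mathcomp Require Import all_classical all_reals all_analysis.
From mathcomp Require Import mxtens ring lra.

(* The bound holds without any dimension factor, already for the Frobenius norm.
   Let [S] be the sum of the centered matrices [F_sym - D_mu P] along the chain,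
   viewed as a vector.  The unipotent matrices [unip z] satisfy
   [unip y *m unip z = unip (y + z)] and have [|z|^2] as their corner entry, so
   that [|S|^(2m)] is an entry of the ordered product along the chain of the
   tensor powers [unip z ^ (tensor m)].  The expectation of such an ordered
   product is an iterate of a tilted kernel acting on the Hilbert space
   [L2(mu; R^N)], a perturbation of [(1 + P) / 2].  Following the component on the
   constants and the component orthogonal to them, the gap yields
   [E |S|^(2m) <= (C m n / eta)^m] for [m] at most a multiple of [n eta], and
   Markov's inequality with [m] proportional to [eta n t^2] concludes. *)

Set Implicit Arguments.
Unset Strict Implicit.
Unset Printing Implicit Defensive.

Import Order.TTheory GRing.Theory Num.Theory.

Local Open Scope classical_set_scope.
Local Open Scope ring_scope.

(** A trace bound on a matrix exponential would pay a power of [d] for the non-commuting summands;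
    scalar even moments of the vectorized sum avoid this. The obstacle is that [|S|^2] is not
    multiplicative along the chain, so no transfer operator computes its moments directly;
    translations acting on quadratic polynomials turn addition of vectors into multiplication. The
    resulting space has dimension [(d^2 + 2)^m], but every estimate used is an operator bound valid
    in any dimension. The smallness comes from a cancellation: the summands have stationary mean
    zero, so the first-order perturbation vanishes on average over a stationary edge, and the
    constant component is affected at first order only through the orthogonal one. For a
    perturbation of size [e] the latter stays of relative order [e / eta], so a step costs a factor
    [1 + O(e^2 / eta)]. Dividing the summands by a scale [r] makes [e = 12 m / r] small. The start
    [nu] enters only through its density with respect to [mu], and rounding [m] to an integer costs
    a constant factor. *)

(** * Weighted Euclidean norms and the Cauchy-Schwarz inequality *)

Section WeightedNorm.
Variable R : realType.

Lemma discriminant_le (a b c : R) :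
  (forall s t, 0 <= a * s ^+ 2 + 2 * b * s * t + c * t ^+ 2) -> b ^+ 2 <= a * c.
Proof.
move=> h; have a0 : 0 <= a by have := h 1 0; lra.
have [a_gt0|] := ltP 0 a.
  have := h (- b) a.
  rewrite (_ : _ + _ = a * (a * c - b ^+ 2)); last by ring.
  by rewrite pmulr_rge0// subr_ge0.
move=> a_le0; have a_eq0 : a = 0 by lra.
rewrite a_eq0 in h *.
have [->|b0] := eqVneq b 0; first by lra.
(* With [a = 0] and [t = 1] the form is affine in [s]; this [s] gives it the value [-1]. *)
have := h (- (c + 1) / (2 * b)) 1.
rewrite (_ : _ + _ = -1); first by lra.
by field.
Qed.

Lemma cauchy_schwarz_sum (I : finType) (c f g : I -> R) :
  (forall i, 0 <= c i) ->
  (\sum_i c i * (f i * g i)) ^+ 2 <=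
  (\sum_i c i * f i ^+ 2) * (\sum_i c i * g i ^+ 2).
Proof.
move=> c0; apply: discriminant_le => s t.
have -> : (\sum_i c i * f i ^+ 2) * s ^+ 2 +
    2 * (\sum_i c i * (f i * g i)) * s * t +
    (\sum_i c i * g i ^+ 2) * t ^+ 2 = \sum_i c i * (s * f i + t * g i) ^+ 2.
  rewrite mulr_sumr !mulr_suml -!big_split/=; apply: eq_bigr => i _; ring.
by apply: sumr_ge0 => i _; rewrite mulr_ge0// sqr_ge0.
Qed.

Definition wnorm (I : finType) (c f : I -> R) : R :=
  Num.sqrt (\sum_i c i * f i ^+ 2).

Section Theory.
Variables (I : finType) (c : I -> R).
Hypothesis c0 : forall i, 0 <= c i.

Lemma wnorm_ge0 f : 0 <= wnorm c f.
Proof. exact: sqrtr_ge0. Qed.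

Lemma wnorm_sqr f : wnorm c f ^+ 2 = \sum_i c i * f i ^+ 2.
Proof.
by rewrite sqr_sqrtr//; apply: sumr_ge0 => i _; rewrite mulr_ge0// sqr_ge0.
Qed.

Lemma wnorm_cs f g : \sum_i c i * (f i * g i) <= wnorm c f * wnorm c g.
Proof.
have w0 := mulr_ge0 (wnorm_ge0 f) (wnorm_ge0 g).
rewrite real_ler_normlW ?num_real// -(ger0_norm w0) -ler_sqr ?nnegrE//.
by rewrite real_normK ?num_real// ger0_norm// exprMn !wnorm_sqr cauchy_schwarz_sum.
Qed.

Lemma wnormD f g : wnorm c (fun i => f i + g i) <= wnorm c f + wnorm c g.
Proof.
rewrite -ler_sqr ?nnegrE ?addr_ge0 ?wnorm_ge0// sqrrD !wnorm_sqr.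
have -> : \sum_i c i * (f i + g i) ^+ 2 = \sum_i c i * f i ^+ 2 +
    (\sum_i c i * (f i * g i)) *+ 2 + \sum_i c i * g i ^+ 2.
  by rewrite -mulr_natl mulr_sumr -!big_split/=; apply: eq_bigr => i _; ring.
by rewrite lerD2r lerD2l lerMn2r/= wnorm_cs.
Qed.

Lemma ler_wnorm f g : (forall i, 0 <= f i <= g i) -> wnorm c f <= wnorm c g.
Proof.
move=> fg; rewrite ler_wsqrtr//; apply: ler_sum => i _.
case/andP: (fg i) => f0 fgi; rewrite ler_wpM2l// ler_sqr ?nnegrE//.
exact: le_trans fgi.
Qed.

Lemma wnormZ a f : 0 <= a -> wnorm c (fun i => a * f i) = a * wnorm c f.
Proof.
move=> a0; rewrite /wnorm -[in RHS](ger0_norm a0) -sqrtr_sqr -sqrtrM ?sqr_ge0//.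
by rewrite mulr_sumr; congr Num.sqrt; apply: eq_bigr => i _; ring.
Qed.

Lemma wnorm_cst a : 0 <= a -> \sum_i c i = 1 -> wnorm c (fun=> a) = a.
Proof. by move=> a0 c1; rewrite /wnorm -mulr_suml c1 mul1r sqrtr_sqr ger0_norm. Qed.

Lemma wnorm_mean f : \sum_i c i = 1 -> \sum_i c i * f i <= wnorm c f.
Proof.
move=> c1; have := wnorm_cs f (fun=> 1).
by rewrite wnorm_cst// mulr1; under eq_bigr do rewrite mulr1.
Qed.

Lemma mean_sqr f : \sum_i c i = 1 ->
  (\sum_i c i * f i) ^+ 2 <= \sum_i c i * f i ^+ 2.
Proof.
move=> c1; have := cauchy_schwarz_sum f (fun=> 1) c0.
under eq_bigr do rewrite mulr1.
by under [X in _ * X]eq_bigr do rewrite expr1n mulr1; rewrite c1 mulr1.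
Qed.

End Theory.
End WeightedNorm.

(** * Euclidean norms of vectors and bounds on matrices *)

Section L2norm.
Variable R : realType.
Implicit Types n m : nat.

Lemma l2norm_wnorm n (x : 'cV[R]_n) : l2norm x = wnorm (fun=> 1) (fun i => x i 0).
Proof. by rewrite /wnorm; under eq_bigr do rewrite mul1r. Qed.

Lemma l2norm_ge0 n (x : 'cV[R]_n) : 0 <= l2norm x.
Proof. exact: sqrtr_ge0. Qed.

Lemma l2norm_sqr n (x : 'cV[R]_n) : l2norm x ^+ 2 = \sum_i x i 0 ^+ 2.
Proof. by rewrite sqr_sqrtr// sumr_ge0// => i _; exact: sqr_ge0. Qed.

Lemma l2norm0 n : l2norm (0 : 'cV[R]_n) = 0.
Proof. by rewrite /l2norm big1 ?sqrtr0// => i _; rewrite mxE expr0n. Qed.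

Lemma l2normD n (x y : 'cV[R]_n) : l2norm (x + y) <= l2norm x + l2norm y.
Proof.
rewrite !l2norm_wnorm; apply: le_trans (wnormD _ _ _) => //.
by rewrite /wnorm; under eq_bigr do rewrite mxE.
Qed.

Lemma l2normZ n a (x : 'cV[R]_n) : l2norm (a *: x) = `|a| * l2norm x.
Proof.
rewrite /l2norm -(sqrtr_sqr a) -sqrtrM ?sqr_ge0// mulr_sumr.
by congr Num.sqrt; apply: eq_bigr => i _; rewrite mxE exprMn.
Qed.

Lemma l2normN n (x : 'cV[R]_n) : l2norm (- x) = l2norm x.
Proof. by rewrite -scaleN1r l2normZ normrN1 mul1r. Qed.

Lemma l2normB n (x y : 'cV[R]_n) : l2norm (x - y) <= l2norm x + l2norm y.
Proof. by rewrite -(l2normN y) l2normD. Qed.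

Lemma l2norm_sum n (I : Type) (r : seq I) (P : pred I) (c : I -> R)
    (x : I -> 'cV[R]_n) : (forall i, P i -> 0 <= c i) ->
  l2norm (\sum_(i <- r | P i) c i *: x i) <= \sum_(i <- r | P i) c i * l2norm (x i).
Proof.
move=> c0; elim/big_ind2: _ => //; first by rewrite l2norm0.
  by move=> x1 y1 x2 y2 h1 h2; apply: le_trans (l2normD _ _) (lerD h1 h2).
by move=> i Pi; rewrite l2normZ ger0_norm ?c0.
Qed.

Lemma coord_le_l2norm n (x : 'cV[R]_n) i : x i 0 <= l2norm x.
Proof.
apply: le_trans (ler_norm _) _; rewrite -sqrtr_sqr ler_wsqrtr//.
by rewrite (bigD1 i)//= lerDl sumr_ge0// => j _; exact: sqr_ge0.
Qed.

Lemma l2norm_delta n (i : 'I_n) : l2norm (delta_mx i 0 : 'cV[R]_n) = 1.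
Proof.
rewrite /l2norm (bigD1 i)//= big1 => [|j ji]; rewrite !mxE ?eqxx/=.
  by rewrite expr1n addr0 sqrtr1.
by rewrite (negbTE ji) expr0n.
Qed.

Lemma l2norm_col_mx m n (x : 'cV[R]_m) (y : 'cV[R]_n) :
  l2norm (col_mx x y) ^+ 2 = l2norm x ^+ 2 + l2norm y ^+ 2.
Proof.
rewrite !l2norm_sqr big_split_ord/=; congr (_ + _);
by apply: eq_bigr => i _; rewrite ?col_mxEu ?col_mxEd.
Qed.

Lemma dot_le_l2norm n (x y : 'cV[R]_n) :
  (x^T *m y) 0 0 ^+ 2 <= l2norm x ^+ 2 * l2norm y ^+ 2.
Proof.
rewrite !l2norm_sqr mxE.
have := @cauchy_schwarz_sum R _ (fun=> 1) (fun i => x i 0) (fun i => y i 0)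
  (fun=> ler01).
have e (f : 'I_n -> R) : \sum_i 1 * f i = \sum_i f i.
  by apply: eq_bigr => i _; rewrite mul1r.
rewrite !e; by under [X in _ -> X ^+ _ <= _]eq_bigr do rewrite mxE.
Qed.

(** A bound stated as a predicate composes under sums, products and tensors without any supremum to
    be shown finite. *)
Definition op_le m n (A : 'M[R]_(m, n)) (c : R) :=
  forall x : 'cV[R]_n, l2norm (A *m x) <= c * l2norm x.

Lemma op_le_trans m n (A : 'M[R]_(m, n)) a b : op_le A a -> a <= b -> op_le A b.
Proof.
by move=> Aa ab x; apply: le_trans (Aa x) _; rewrite ler_wpM2r// l2norm_ge0.
Qed.

Lemma op_leD m n (A B : 'M[R]_(m, n)) a b :
  op_le A a -> op_le B b -> op_le (A + B) (a + b).
Proof.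
move=> Aa Bb x; rewrite mulmxDl mulrDl.
by apply: le_trans (l2normD _ _) (lerD (Aa x) (Bb x)).
Qed.

Lemma op_leM m n q (A : 'M[R]_(m, n)) (B : 'M[R]_(n, q)) a b : 0 <= a ->
  op_le A a -> op_le B b -> op_le (A *m B) (a * b).
Proof.
move=> a0 Aa Bb x; rewrite -mulmxA -mulrA; apply: le_trans (Aa _) _.
by rewrite ler_wpM2l.
Qed.

Lemma op_le0 m n : op_le (0 : 'M[R]_(m, n)) 0.
Proof. by move=> x; rewrite mul0mx l2norm0 mul0r. Qed.

Lemma op_le1 n : op_le (1%:M : 'M[R]_n) 1.
Proof. by move=> x; rewrite mul1mx mul1r. Qed.

Lemma op_le_sqr m n (A : 'M[R]_(m, n)) c : 0 <= c ->
  (forall x, l2norm (A *m x) ^+ 2 <= c ^+ 2 * l2norm x ^+ 2) -> op_le A c.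
Proof.
move=> c0 Ac x; rewrite -ler_sqr ?nnegrE ?mulr_ge0 ?l2norm_ge0//.
by rewrite exprMn.
Qed.

Lemma op_le_sum m n (I : finType) (c : I -> R) (A : I -> 'M[R]_(m, n)) a :
  (forall i, 0 <= c i) -> \sum_i c i = 1 -> (forall i, op_le (A i) a) ->
  op_le (\sum_i c i *: A i) a.
Proof.
move=> c0 c1 Aa x; rewrite mulmx_suml.
under eq_bigr do rewrite -scalemxAl.
apply: le_trans (l2norm_sum _ _ _) _ => //.
rewrite -[leRHS]mul1r -c1 mulr_suml; apply: ler_sum => i _.
by rewrite ler_wpM2l//; exact: Aa.
Qed.

Lemma sum_mxtens_index m n (F : 'I_(m * n) -> R) :
  \sum_k F k = \sum_i \sum_j F (mxtens_index (i, j)).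
Proof.
rewrite pair_big/= (reindex (@mxtens_index m n)) /=.
  by apply: eq_bigr => -[].
by exists (@mxtens_unindex m n) => k _; rewrite ?mxtens_indexK ?mxtens_unindexK.
Qed.

(** The matrix acts separately on the slices [y j] of [x] with fixed second index, and the squared
    norms of the slices add up to that of [x]. *)
Lemma op_le_tensl m n q (A : 'M[R]_(m, n)) a : 0 <= a ->
  op_le A a -> op_le (A *t (1%:M : 'M[R]_q)) a.
Proof.
move=> a0 Aa; apply: op_le_sqr => // x.
pose y j : 'cV[R]_n := \col_i x (mxtens_index (i, j)) 0.
rewrite !l2norm_sqr !sum_mxtens_index exchange_big [in leRHS]exchange_big/= mulr_sumr.
apply: ler_sum => j _.
have -> : \sum_i (A *t 1%:M *m x) (mxtens_index (i, j)) 0 ^+ 2 = l2norm (A *m y j) ^+ 2.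
  rewrite l2norm_sqr; apply: eq_bigr => i _; congr (_ ^+ 2).
  rewrite !mxE sum_mxtens_index; apply: eq_bigr => k _.
  rewrite (bigD1 j)//= big1 => [|l lj]; rewrite tensmxE !mxE ?eqxx ?mulr1 ?addr0//.
  by rewrite eq_sym (negbTE lj) mulr0 mul0r.
have -> : \sum_i x (mxtens_index (i, j)) 0 ^+ 2 = l2norm (y j) ^+ 2.
  by rewrite l2norm_sqr; apply: eq_bigr => i _; rewrite mxE.
by rewrite -exprMn ler_sqr ?nnegrE ?mulr_ge0 ?l2norm_ge0.
Qed.

Lemma op_le_tensr m n q (A : 'M[R]_(m, n)) a : 0 <= a ->
  op_le A a -> op_le ((1%:M : 'M[R]_q) *t A) a.
Proof.
move=> a0 Aa; apply: op_le_sqr => // x.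
pose y i : 'cV[R]_n := \col_j x (mxtens_index (i, j)) 0.
rewrite !l2norm_sqr !sum_mxtens_index mulr_sumr.
apply: ler_sum => i _.
have -> : \sum_j (1%:M *t A *m x) (mxtens_index (i, j)) 0 ^+ 2 = l2norm (A *m y i) ^+ 2.
  rewrite l2norm_sqr; apply: eq_bigr => j _; congr (_ ^+ 2).
  rewrite !mxE sum_mxtens_index (bigD1 i)//= [X in _ + X]big1 => [|k ki].
    by rewrite addr0; apply: eq_bigr => l _; rewrite tensmxE !mxE eqxx mul1r.
  apply: big1 => l _; rewrite tensmxE !mxE eq_sym (negbTE ki).
  by rewrite !mul0r.
have -> : \sum_j x (mxtens_index (i, j)) 0 ^+ 2 = l2norm (y i) ^+ 2.
  by rewrite l2norm_sqr; apply: eq_bigr => j _; rewrite mxE.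
by rewrite -exprMn ler_sqr ?nnegrE ?mulr_ge0 ?l2norm_ge0.
Qed.

End L2norm.

(** * Tensor powers and their expansion near the identity *)

Section TensorPower.
Variable R : realType.

Lemma tensmxDl m n p q (A B : 'M[R]_(m, n)) (C : 'M[R]_(p, q)) :
  (A + B) *t C = A *t C + B *t C.
Proof.
apply/matrixP => i j; case: (mxtens_indexP i) => i1 i2.
case: (mxtens_indexP j) => j1 j2.
by rewrite tensmxE [in LHS]mxE [in RHS]mxE !tensmxE mulrDl.
Qed.

Lemma tensmxDr m n p q (C : 'M[R]_(m, n)) (A B : 'M[R]_(p, q)) :
  C *t (A + B) = C *t A + C *t B.
Proof.
apply/matrixP => i j; case: (mxtens_indexP i) => i1 i2.
case: (mxtens_indexP j) => j1 j2.
by rewrite tensmxE [in LHS]mxE [in RHS]mxE !tensmxE mulrDr.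
Qed.

Lemma tensmxZl m n p q a (A : 'M[R]_(m, n)) (C : 'M[R]_(p, q)) :
  (a *: A) *t C = a *: (A *t C).
Proof.
apply/matrixP => i j; case: (mxtens_indexP i) => i1 i2.
case: (mxtens_indexP j) => j1 j2.
by rewrite tensmxE [in LHS]mxE [in RHS]mxE !tensmxE mulrA.
Qed.

Lemma tensmxZr m n p q a (C : 'M[R]_(m, n)) (A : 'M[R]_(p, q)) :
  C *t (a *: A) = a *: (C *t A).
Proof.
apply/matrixP => i j; case: (mxtens_indexP i) => i1 i2.
case: (mxtens_indexP j) => j1 j2.
by rewrite tensmxE [in LHS]mxE [in RHS]mxE !tensmxE mulrCA.
Qed.

Lemma tensmxBl m n p q (A B : 'M[R]_(m, n)) (C : 'M[R]_(p, q)) :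
  (A - B) *t C = A *t C - B *t C.
Proof. by rewrite -scaleN1r tensmxDl tensmxZl scaleN1r. Qed.

Lemma tensmxBr m n p q (C : 'M[R]_(m, n)) (A B : 'M[R]_(p, q)) :
  C *t (A - B) = C *t A - C *t B.
Proof. by rewrite -scaleN1r tensmxDr tensmxZr scaleN1r. Qed.

Lemma tensmx11 m n : (1%:M : 'M[R]_m) *t (1%:M : 'M[R]_n) = 1%:M.
Proof.
apply/matrixP => i j; case: (mxtens_indexP i) => i1 i2.
case: (mxtens_indexP j) => j1 j2; rewrite tensmxE !mxE.
rewrite (can_eq (@mxtens_indexK m n)) xpair_eqE.
by rewrite -natrM mulnb.
Qed.

Fixpoint tdim (n m : nat) : nat := if m is m'.+1 then (n * tdim n m')%N else 1.

Fixpoint tpow n (A : 'M[R]_n) m : 'M[R]_(tdim n m) :=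
  if m is m'.+1 then A *t tpow A m' else 1%:M.

(* The derivative of [tpow] at the identity in the direction [A]. *)
Fixpoint tder n (A : 'M[R]_n) m : 'M[R]_(tdim n m) :=
  if m is m'.+1 then A *t 1%:M + 1%:M *t tder A m' else 0.

Fixpoint tidx n (i : 'I_n) m : 'I_(tdim n m) :=
  if m is m'.+1 then mxtens_index (i, tidx i m') else ord0.

Lemma tpow1 n m : tpow (1%:M : 'M[R]_n) m = 1%:M.
Proof. by elim: m => //= m ->; rewrite tensmx11. Qed.

Lemma tpowM n (A B : 'M[R]_n) m : tpow (A *m B) m = tpow A m *m tpow B m.
Proof. by elim: m => /= [|m ->]; rewrite ?mulmx1// tensmx_mul. Qed.

Lemma tpowE n (A : 'M[R]_n) i j m : tpow A m (tidx i m) (tidx j m) = A i j ^+ m.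
Proof. by elim: m => [|m IH] /=; [rewrite mxE|rewrite tensmxE IH exprS]. Qed.

Lemma tderD n (A B : 'M[R]_n) m : tder (A + B) m = tder A m + tder B m.
Proof.
by elim: m => /= [|m ->]; rewrite ?addr0// tensmxDl tensmxDr addrACA.
Qed.

Lemma tderZ n a (A : 'M[R]_n) m : tder (a *: A) m = a *: tder A m.
Proof.
by elim: m => /= [|m ->]; rewrite ?scaler0// tensmxZl tensmxZr scalerDr.
Qed.

Lemma tder0 n m : tder (0 : 'M[R]_n) m = 0.
Proof. by rewrite -[0](scale0r 0) tderZ scale0r. Qed.

Lemma tder_sum n m (I : finType) (c : I -> R) (A : I -> 'M[R]_n) :
  \sum_i c i *: tder (A i) m = tder (\sum_i c i *: A i) m.
Proof.
elim/big_rec2: _ => [|i B C _ ->]; first by rewrite tder0.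
by rewrite tderD tderZ.
Qed.

Section Bounds.
Variables (n : nat) (A B : 'M[R]_n) (a : R).
Hypotheses (a0 : 0 <= a) (B1 : op_le (B - 1%:M) a).
Hypothesis B2 : op_le (B - 1%:M - A) (a ^+ 2).

Let B_le : op_le B (1 + a).
Proof. by rewrite -[B](addrNK 1%:M) addrC; apply: op_leD => //; exact: op_le1. Qed.

Let a1 : 0 <= 1 + a. Proof. by rewrite addr_ge0. Qed.

(** One tensor factor is replaced by the identity at a time; the error then obeys the recursion
    [x -> (1 + a) x + a]. *)
Lemma tpow_sub1 m : op_le (tpow B m - 1%:M) ((1 + a) ^+ m - 1).
Proof.
elim: m => [|m IH] /=; first by rewrite !subrr; exact: op_le0.
have a1m : 0 <= (1 + a) ^+ m - 1 by rewrite subr_ge0 exprn_ege1// lerDl.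
have -> : B *t tpow B m - 1%:M =
    (B *t 1%:M) *m (1%:M *t (tpow B m - 1%:M)) + (B - 1%:M) *t 1%:M.
  rewrite tensmx_mul mulmx1 mul1mx -tensmx11 tensmxBr tensmxBl.
  by rewrite addrA addrNK.
rewrite (_ : _ - 1 = (1 + a) * ((1 + a) ^+ m - 1) + a); last by rewrite exprS; ring.
apply: op_leD; last exact: op_le_tensl.
by apply: op_leM => //; [exact: op_le_tensl|exact: op_le_tensr].
Qed.

(** The same telescoping to second order: [(1 + a)^m - 1 - m a] collects the products of at least
    two deviations, and [m a^2] the error of [A] as linearization of [B - 1] in each of the [m]
    factors. *)
Lemma tpow_sub2 m : op_le (tpow B m - 1%:M - tder A m)
  ((1 + a) ^+ m - 1 - m%:R * a + m%:R * a ^+ 2).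
Proof.
elim: m => [|m IH] /=.
  rewrite expr0 !mul0r subrr !addr0 !subrr; exact: op_le0.
have a1m : 0 <= (1 + a) ^+ m - 1 by rewrite subr_ge0 exprn_ege1// lerDl.
have bern : m%:R * a <= (1 + a) ^+ m - 1.
  elim: (m) => [|k IHk]; first by rewrite mul0r expr0 subrr.
  have k0 : 0 <= k%:R * a ^+ 2 by rewrite mulr_ge0// sqr_ge0.
  have : (1 + a) * (k%:R * a) <= (1 + a) * ((1 + a) ^+ k - 1) by rewrite ler_wpM2l.
  by rewrite exprS -natr1; nra.
have -> : B *t tpow B m - 1%:M - (A *t 1%:M + 1%:M *t tder A m) =
    ((B - 1%:M) *t 1%:M) *m (1%:M *t (tpow B m - 1%:M)) +
    (1%:M *t (tpow B m - 1%:M - tder A m) + (B - 1%:M - A) *t 1%:M).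
  rewrite tensmx_mul mulmx1 mul1mx -tensmx11.
  rewrite !(tensmxBl, tensmxBr).
  set x := B *t tpow B m; set y := 1%:M *t 1%:M; set z := 1%:M *t tpow B m.
  set w := B *t 1%:M; set u := A *t 1%:M; set v := 1%:M *t tder A m.
  apply/matrixP => i j; rewrite !mxE; ring.
rewrite (_ : _ + _ = a * ((1 + a) ^+ m - 1) +
    ((1 + a) ^+ m - 1 - m%:R * a + m%:R * a ^+ 2 + a ^+ 2)); last first.
  by rewrite exprS -natr1; ring.
apply: op_leD; last apply: op_leD.
- apply: op_leM => //; first exact: op_le_tensl.
  by apply: op_le_tensr => //; exact: tpow_sub1.
- apply: op_le_tensr => //.
  by rewrite addr_ge0 ?subr_ge0// mulr_ge0// sqr_ge0.
- by apply: op_le_tensl => //; exact: sqr_ge0.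
Qed.

Variable m : nat.
Hypothesis ma1 : m%:R * a <= 1.

Let expr1D_le : (1 + a) ^+ m <= 1 + m%:R * a + (m%:R * a) ^+ 2.
Proof.
elim: m ma1 => [|k IH]; first by rewrite expr0 !mul0r expr0n !addr0.
rewrite -[k.+1%:R]natr1 => ka; rewrite exprS.
have k0 : 0 <= k%:R :> R by [].
rewrite mulrDl mul1r in ka; have ka1 : k%:R * a <= 1 by apply: le_trans ka; rewrite lerDl.
have : (1 + a) * (1 + a) ^+ k <= (1 + a) * (1 + k%:R * a + (k%:R * a) ^+ 2).
  by rewrite ler_wpM2l// IH.
have : (k%:R * a ^+ 2) * (k%:R * a) <= k%:R * a ^+ 2 * 1.
  by rewrite ler_wpM2l// mulr_ge0// sqr_ge0.
have := mulr_ge0 k0 (sqr_ge0 a); have := sqr_ge0 a.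
nra.
Qed.

Lemma tpow_sub1_le : op_le (tpow B m - 1%:M) (2 * m%:R * a).
Proof.
apply: op_le_trans (@tpow_sub1 m) _.
have ma0 : 0 <= m%:R * a by rewrite mulr_ge0.
have ma2 : (m%:R * a) ^+ 2 <= m%:R * a by rewrite expr2 ler_piMr.
by have := expr1D_le; lra.
Qed.

(** The remainder is in fact at most [2 (m a)^2]; the weaker form makes the two bounds [e] and [e^2]
    for the same [e = 2 m a], as the tilted kernel requires. *)
Lemma tpow_sub2_le : op_le (tpow B m - 1%:M - tder A m) ((2 * m%:R * a) ^+ 2).
Proof.
apply: op_le_trans (@tpow_sub2 m) _.
have ma0 : 0 <= m%:R * a by rewrite mulr_ge0.
have mm : m%:R * a ^+ 2 <= (m%:R * a) ^+ 2.
  rewrite exprMn ler_wpM2r ?sqr_ge0// expr2 -natrM ler_nat.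
  by case: (m) => // k; rewrite leq_pmulr.
by have := expr1D_le; have := sqr_ge0 (m%:R * a); nra.
Qed.

End Bounds.
End TensorPower.

(** * Unipotent matrices that turn addition of vectors into multiplication *)

Section Unipotent.
Variables (R : realType) (n : nat).
Implicit Types y z : 'cV[R]_n.

Definition unip_corner (c : R) : 'M[R]_(1 + (n + 1)) :=
  block_mx 0 (row_mx 0 c%:M) 0 0.

Definition unip_gen z : 'M[R]_(1 + (n + 1)) :=
  block_mx 0 (row_mx z^T 0) 0 (block_mx 0 (2 *: z) 0 0).

(* The matrix of [q |-> q (. + z)] on the polynomials
   [q x = c + <v, x> + b |x|^2], in the coordinates (c, v, b). *)
Definition unip z : 'M[R]_(1 + (n + 1)) :=
  1%:M + unip_gen z + unip_corner (l2norm z ^+ 2).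

Lemma unip_gen0 : unip_gen 0 = 0.
Proof. by rewrite /unip_gen scaler0 trmx0 row_mx0 !block_mx0. Qed.

Lemma unip_genD y z : unip_gen (y + z) = unip_gen y + unip_gen z.
Proof.
rewrite /unip_gen !(add_block_mx, add_row_mx) !addr0 scalerDr.
by congr (block_mx _ (row_mx _ _) _ _); apply/matrixP => i j; rewrite !mxE.
Qed.

Lemma unip_genZ a z : unip_gen (a *: z) = a *: unip_gen z.
Proof.
rewrite /unip_gen !(scale_block_mx, scale_row_mx) !scaler0 scalerA mulrC -scalerA.
by congr (block_mx _ (row_mx _ _) _ _); apply/matrixP => i j; rewrite !mxE.
Qed.

Lemma unip_gen_sum (I : finType) (c : I -> R) (z : I -> 'cV[R]_n) :
  \sum_i c i *: unip_gen (z i) = unip_gen (\sum_i c i *: z i).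
Proof.
elim/big_rec2: _ => [|i B C _ ->]; first by rewrite unip_gen0.
by rewrite unip_genD unip_genZ.
Qed.

Lemma unip_genM y z :
  unip_gen y *m unip_gen z = unip_corner (2 * (y^T *m z) 0 0).
Proof.
rewrite /unip_gen /unip_corner !(mulmx_block, mul_row_block).
rewrite !(mul0mx, mulmx0, addr0, add0r) block_mx0 -scalemxAr.
congr (block_mx _ (row_mx _ _) _ _).
by rewrite [y^T *m z]mx11_scalar scale_scalar_mx !mxE.
Qed.

Lemma unip_corner_gen c z : unip_corner c *m unip_gen z = 0.
Proof.
rewrite /unip_gen /unip_corner !(mulmx_block, mul_row_block).
by rewrite !(mul0mx, mulmx0, addr0, add0r) row_mx0 block_mx0.
Qed.

Lemma unip_gen_corner c z : unip_gen z *m unip_corner c = 0.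
Proof.
rewrite /unip_gen /unip_corner !(mulmx_block, mul_row_block).
by rewrite !(mul0mx, mulmx0, addr0, add0r) block_mx0.
Qed.

Lemma unip_cornerM c c' : unip_corner c *m unip_corner c' = 0.
Proof.
rewrite /unip_corner !(mulmx_block, mul_row_block).
by rewrite !(mul0mx, mulmx0, addr0, add0r) block_mx0.
Qed.

Lemma unip_cornerD c c' : unip_corner (c + c') = unip_corner c + unip_corner c'.
Proof.
by rewrite /unip_corner add_block_mx add_row_mx !addr0 raddfD.
Qed.

Lemma l2norm_sqrD y z :
  l2norm (y + z) ^+ 2 = l2norm y ^+ 2 + l2norm z ^+ 2 + 2 * (y^T *m z) 0 0.
Proof.
rewrite !l2norm_sqr !mxE mulr_sumr -!big_split/=.
by apply: eq_bigr => i _; rewrite !mxE; ring.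
Qed.

(** The product of two generators is a corner matrix with entry [2 <y, z>], exactly the cross term
    of [|y + z|^2]; all products with a corner factor vanish. *)
Lemma unipM y z : unip y *m unip z = unip (y + z).
Proof.
rewrite /unip !mulmxDl !mulmxDr !(mul1mx, mulmx1) unip_genM unip_gen_corner.
rewrite unip_corner_gen unip_cornerM !addr0 unip_genD l2norm_sqrD !unip_cornerD.
by apply/matrixP => i j; rewrite !mxE; ring.
Qed.

Lemma unip0 : unip 0 = 1%:M.
Proof.
rewrite /unip unip_gen0 l2norm0 addr0 expr0n/= /unip_corner raddf0 row_mx0.
by rewrite block_mx0 addr0.
Qed.

Lemma unipE z : unip z (lshift _ 0) (rshift 1 (rshift n 0)) = l2norm z ^+ 2.
Proof.
rewrite /unip 2!mxE [X in X + _ + _]mxE /unip_gen /unip_corner !block_mxEur.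
by rewrite !row_mxEr !mxE/= !add0r.
Qed.

Lemma op_le_corner c : 0 <= c -> op_le (unip_corner c) c.
Proof.
move=> c0; apply: op_le_sqr => // x.
rewrite -[x]vsubmxK -[dsubmx x]vsubmxK; set b := usubmx _; set v := usubmx _.
set w := dsubmx (dsubmx x).
rewrite /unip_corner mul_block_col mul_row_col !(mul0mx, add0r) !l2norm_col_mx.
rewrite l2norm0 expr0n addr0 mul_scalar_mx l2normZ ger0_norm// exprMn.
by rewrite ler_wpM2l ?sqr_ge0// addrA lerDr addr_ge0// sqr_ge0.
Qed.

Lemma op_le_gen z : op_le (unip_gen z) (2 * l2norm z).
Proof.
apply: op_le_sqr => [|x]; first by rewrite mulr_ge0// l2norm_ge0.
rewrite -[x]vsubmxK -[dsubmx x]vsubmxK; set b := usubmx _; set v := usubmx _.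
set w := dsubmx (dsubmx x).
rewrite /unip_gen !mul_block_col mul_row_col !(mul0mx, add0r, addr0) !l2norm_col_mx.
rewrite l2norm0 expr0n addr0 [w]mx11_scalar mul_mx_scalar !l2normZ.
rewrite [l2norm (_%:M) ^+ 2]l2norm_sqr big_ord1 !mxE/= mulr1n.
rewrite [l2norm (z^T *m v) ^+ 2]l2norm_sqr big_ord1.
rewrite exprMn exprMn !real_normK ?num_real// exprMn.
have := dot_le_l2norm z v.
have := mulr_ge0 (sqr_ge0 (l2norm z)) (sqr_ge0 (l2norm v)).
have := mulr_ge0 (sqr_ge0 (l2norm z)) (sqr_ge0 (l2norm b)).
nra.
Qed.

Section Bounds.
Variables (z : 'cV[R]_n) (a : R).
Hypothesis za : l2norm z <= a.
Hypothesis a1 : a <= 1.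

Let a0 : 0 <= a. Proof. exact: le_trans (l2norm_ge0 z) za. Qed.

Let unip_subE : unip z - 1%:M = unip_gen z + unip_corner (l2norm z ^+ 2).
Proof. by rewrite /unip -(addrA 1%:M) [LHS]addrC addKr. Qed.

(** The generator contributes [2 |z|] and the corner [|z|^2 <= |z|], whence the factor 3. *)
Lemma unip_sub1 : op_le (unip z - 1%:M) (3 * a).
Proof.
rewrite unip_subE.
have z0 := l2norm_ge0 z.
apply: (@op_le_trans _ _ _ _ (2 * l2norm z + l2norm z ^+ 2)); last first.
  have : l2norm z ^+ 2 <= l2norm z by rewrite expr2 ler_piMr// (le_trans za).
  by move: za; lra.
by apply: op_leD; [exact: op_le_gen|exact/op_le_corner/sqr_ge0].
Qed.

Lemma unip_sub2 : op_le (unip z - 1%:M - unip_gen z) ((3 * a) ^+ 2).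
Proof.
rewrite unip_subE addrAC subrr add0r.
have z0 := l2norm_ge0 z.
apply: (@op_le_trans _ _ _ _ (l2norm z ^+ 2)); last first.
  by rewrite ler_sqr ?nnegrE ?mulr_ge0//; move: za a0; lra.
exact/op_le_corner/sqr_ge0.
Qed.

End Bounds.
End Unipotent.

(** * Reversible kernels and the lazy walk *)

Section ReversibleKernel.
Variables (R : realType) (Omega : finType) (p : Omega -> Omega -> R).
Variables (mu : Omega -> R) (eta : R).
Hypotheses (tp : is_transition p) (dmu : is_distribution mu).
Hypothesis rev : is_reversible p mu.
Hypothesis gap : forall h, \sum_u mu u * h u = 0 ->
  inner mu h (kernel_act p h) <= (1 - eta) * inner mu h h.
Hypothesis eta2 : eta <= 2.

Let mu0 u : 0 <= mu u. Proof. exact: dmu.1. Qed.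
Let mu1 : \sum_u mu u = 1. Proof. exact: dmu.2. Qed.
Let p0 u v : 0 <= p u v. Proof. exact: (tp u).1. Qed.
Let p1 u : \sum_v p u v = 1. Proof. exact: (tp u).2. Qed.

Lemma reversible_swap (V : lmodType R) (G : Omega -> Omega -> V) :
  \sum_u \sum_v (mu u * p u v) *: G u v = \sum_u \sum_v (mu u * p u v) *: G v u.
Proof.
rewrite exchange_big; apply: eq_bigr => u _; apply: eq_bigr => v _.
by rewrite rev.
Qed.

Lemma sum_edge_fst (V : lmodType R) (f : Omega -> V) :
  \sum_u \sum_v (mu u * p u v) *: f u = \sum_u mu u *: f u.
Proof.
apply: eq_bigr => u _; rewrite -scaler_suml -mulr_sumr p1 mulr1//.
Qed.

Lemma sum_edge_mid (V : lmodType R) (f : Omega -> V) :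
  \sum_u \sum_v (mu u * p u v) *: (2^-1 *: (f u + f v)) = \sum_u mu u *: f u.
Proof.
have -> : \sum_u \sum_v (mu u * p u v) *: (2^-1 *: (f u + f v)) =
    2^-1 *: (\sum_u \sum_v (mu u * p u v) *: f u +
             \sum_u \sum_v (mu u * p u v) *: f v).
  rewrite -big_split /= scaler_sumr; apply: eq_bigr => u _ /=.
  rewrite -big_split /= scaler_sumr; apply: eq_bigr => v _ /=.
  by rewrite -scalerDr !scalerA mulrC.
rewrite -(reversible_swap (fun u _ => f u)) sum_edge_fst scalerDr -scalerDl.
by rewrite -[2^-1]mul1r -splitr scale1r.
Qed.

(* The kernel [(1 + p) / 2] is that of the walk [w_2] on the vertices; it is
   positive semidefinite, so that no bound on the negative spectrum of [p] is
   needed. *)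
Definition lazy (V : lmodType R) (f : Omega -> V) u : V :=
  \sum_v p u v *: (2^-1 *: (f u + f v)).

Lemma mean_lazy (V : lmodType R) (f : Omega -> V) :
  \sum_u mu u *: lazy f u = \sum_u mu u *: f u.
Proof.
rewrite -[RHS]sum_edge_mid; apply: eq_bigr => u _; rewrite /lazy scaler_sumr.
by under eq_bigr do rewrite scalerA.
Qed.

(** This is [<(1 + P) / 2 f, g>] in [L2(mu)], written as a product of averages over the ends of a
    stationary edge, which displays its symmetry and positivity. *)
Definition edge_form (f g : Omega -> R) : R :=
  \sum_(e : Omega * Omega) (mu e.1 * p e.1 e.2) *
    (2^-1 * (f e.1 + f e.2) * (2^-1 * (g e.1 + g e.2))).

Lemma edge_formE f g :
  edge_form f g = \sum_u mu u * (lazy (f : Omega -> R^o) u * g u).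
Proof.
have -> : edge_form f g = \sum_u \sum_v (mu u * p u v) *:
    (2^-1 *: ((2^-1 * (f u + f v) * g u : R^o) + (2^-1 * (f u + f v) * g v : R^o))).
  rewrite /edge_form -(pair_bigA _ (fun u v => (mu u * p u v) *
    (2^-1 * (f u + f v) * (2^-1 * (g u + g v)))))/=.
  apply: eq_bigr => u _; apply: eq_bigr => v _; rewrite /GRing.scale/=; ring.
have -> : \sum_u mu u * (lazy (f : Omega -> R^o) u * g u) =
    \sum_u \sum_v (mu u * p u v) *: (2^-1 * (f u + f v) * g u : R^o).
  apply: eq_bigr => u _; rewrite /lazy mulr_suml mulr_sumr.
  by apply: eq_bigr => v _; rewrite /GRing.scale/=; ring.
transitivity (2^-1 *: (\sum_u \sum_v (mu u * p u v) *: (2^-1 * (f u + f v) * g u : R^o)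
  + \sum_u \sum_v (mu u * p u v) *: (2^-1 * (f u + f v) * g v : R^o))).
  rewrite -big_split /= scaler_sumr; apply: eq_bigr => u _ /=.
  rewrite -big_split /= scaler_sumr; apply: eq_bigr => v _ /=.
  by rewrite /GRing.scale/=; ring.
have <- : \sum_u \sum_v (mu u * p u v) *: (2^-1 * (f u + f v) * g u : R^o) =
    \sum_u \sum_v (mu u * p u v) *: (2^-1 * (f u + f v) * g v : R^o).
  rewrite (reversible_swap (fun u v => 2^-1 * (f u + f v) * g u : R^o)).
  by apply: eq_bigr => u _; apply: eq_bigr => v _; rewrite [f v + _]addrC.
by rewrite scalerDr -scalerDl -[2^-1]mul1r -splitr scale1r.
Qed.

Lemma edge_form_gap b : \sum_u mu u * b u = 0 ->
  edge_form b b <= (1 - eta / 2) * \sum_u mu u * b u ^+ 2.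
Proof.
move=> b0; have := gap b0; rewrite /inner edge_formE.
have -> : \sum_u mu u * b u * b u = \sum_u mu u * b u ^+ 2.
  by apply: eq_bigr => u _; ring.
have -> : \sum_u mu u * (lazy (b : Omega -> R^o) u * b u) =
    2^-1 * (\sum_u mu u * b u ^+ 2 + \sum_u mu u * b u * kernel_act p b u).
  rewrite -big_split mulr_sumr; apply: eq_bigr => u _ /=.
  have -> : lazy (b : Omega -> R^o) u = 2^-1 * (b u + kernel_act p b u).
    rewrite /lazy /kernel_act -[X in X + _]mul1r -(p1 u) mulr_suml -big_split.
    by rewrite mulr_sumr; apply: eq_bigr => v _; rewrite /GRing.scale/=; ring.
  by ring.
lra.
Qed.

(** Passes from the quadratic form to the norm without diagonalizing. With [c] the image of [b],
    [X = |c|^2 = edge_form b c], and Cauchy-Schwarz for the positive form gives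
    [X^2 <= edge_form b b * edge_form c c]. Both factors are controlled by the gap, as [c] also has
    mean zero; dividing by [X] concludes. *)
Lemma lazy_gap b : \sum_u mu u * b u = 0 ->
  \sum_u mu u * lazy (b : Omega -> R^o) u ^+ 2 <=
  (1 - eta / 2) ^+ 2 * \sum_u mu u * b u ^+ 2.
Proof.
move=> b0; set c : Omega -> R := lazy _; set X := \sum_u mu u * c u ^+ 2.
have c0 : \sum_u mu u * c u = 0 by have := mean_lazy (b : Omega -> R^o) => ->.
have bX : edge_form b c = X.
  by rewrite edge_formE; apply: eq_bigr => u _; rewrite expr2.
have cs : X ^+ 2 <= edge_form b b * edge_form c c.
  rewrite -bX; apply: le_trans (cauchy_schwarz_sum _ _ _) _.
    by move=> e; rewrite mulr_ge0.
  rewrite le_eqVlt; apply/orP; left; apply/eqP.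
  by congr (_ * _); apply: eq_bigr => e _; rewrite expr2.
have form_ge0 f : 0 <= edge_form f f.
  by apply: sumr_ge0 => e _; rewrite -expr2; apply: mulr_ge0; [exact: mulr_ge0|exact: sqr_ge0].
have X0 : 0 <= X by apply: sumr_ge0 => u _; rewrite mulr_ge0 ?sqr_ge0.
have Y0 : 0 <= \sum_u mu u * b u ^+ 2.
  by apply: sumr_ge0 => u _; rewrite mulr_ge0 ?sqr_ge0.
have : edge_form b b * edge_form c c <=
    ((1 - eta / 2) * \sum_u mu u * b u ^+ 2) * ((1 - eta / 2) * X).
  by rewrite ler_pM ?form_ge0// edge_form_gap.
move=> /(le_trans cs).
have [->|Xn0] := eqVneq X 0; first by rewrite mulr_ge0 ?sqr_ge0.
have Xp : 0 < X by rewrite lt_neqAle eq_sym Xn0.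
by rewrite expr2 mulrA ler_pM2r// mulrAC -expr2.
Qed.

(** Jensen twice, for the average over [v] and for the midpoint, then stationarity of both ends of
    an edge. It serves to bound the perturbation, which is dominated pointwise by the lazy walk of
    the norms. *)
Lemma lazy_contraction (f : Omega -> R) :
  \sum_u mu u * lazy (f : Omega -> R^o) u ^+ 2 <= \sum_u mu u * f u ^+ 2.
Proof.
have -> : \sum_u mu u * f u ^+ 2 =
    \sum_u \sum_v (mu u * p u v) *: (2^-1 *: ((f u ^+ 2 : R^o) + (f v ^+ 2 : R^o))).
  by rewrite (sum_edge_mid (fun u => f u ^+ 2 : R^o)).
apply: ler_sum => u _.
under [leRHS]eq_bigr do rewrite -scalerA.
rewrite -scaler_sumr /GRing.scale/= ler_wpM2l//.
apply: le_trans (mean_sqr _ _ _) _ => //.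
apply: ler_sum => v _; rewrite ler_wpM2l// /GRing.scale/=.
by have := sqr_ge0 (f u - f v); nra.
Qed.

(** * The tilted kernel on vector-valued functions *)

Section VectorValued.
Variable N : nat.
Implicit Types (h : Omega -> 'cV[R]_N).

Definition vmean h : 'cV[R]_N := \sum_u mu u *: h u.

Definition vdev h : R := wnorm mu (fun u => l2norm (h u - vmean h)).

Lemma vmean_dev h : \sum_u mu u *: (h u - vmean h) = 0.
Proof.
rewrite (eq_bigr _ (fun u _ => scalerBr (mu u) (h u) (vmean h))) sumrB.
by rewrite -scaler_suml mu1 scale1r subrr.
Qed.

Lemma wnorm_l2norm_sqr h :
  wnorm mu (fun u => l2norm (h u)) ^+ 2 = \sum_i \sum_u mu u * h u i 0 ^+ 2.
Proof.
rewrite wnorm_sqr// exchange_big; apply: eq_bigr => u _.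
by rewrite l2norm_sqr mulr_sumr.
Qed.

Lemma wnorm_l2normD h k : wnorm mu (fun u => l2norm (h u + k u)) <=
  wnorm mu (fun u => l2norm (h u)) + wnorm mu (fun u => l2norm (k u)).
Proof.
apply: le_trans (wnormD _ _ _) => //; apply: ler_wnorm => // u.
by rewrite l2norm_ge0 l2normD.
Qed.

Lemma vdev_le h : vdev h <= wnorm mu (fun u => l2norm (h u)).
Proof.
rewrite -ler_sqr ?nnegrE ?wnorm_ge0//.
rewrite (wnorm_l2norm_sqr (fun u => h u - vmean h)) wnorm_l2norm_sqr.
apply: ler_sum => i _; set m := vmean h i 0.
have mE : m = \sum_u mu u * h u i 0.
  by rewrite /m summxE; apply: eq_bigr => u _; rewrite mxE.
have -> : \sum_u mu u * h u i 0 ^+ 2 =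
    \sum_u mu u * (h u - vmean h) i 0 ^+ 2 + m ^+ 2.
  transitivity (\sum_u (mu u * (h u - vmean h) i 0 ^+ 2 +
      (2 * m * (mu u * h u i 0) - mu u * m ^+ 2))).
    by apply: eq_bigr => u _; rewrite !mxE -/m; ring.
  by rewrite big_split sumrB/= -mulr_sumr -mE -mulr_suml mu1; ring.
by rewrite lerDl sqr_ge0.
Qed.

Lemma wnorm_le_vdev h : wnorm mu (fun u => l2norm (h u)) <= vdev h + l2norm (vmean h).
Proof.
have := wnorm_l2normD (fun u => h u - vmean h) (fun=> vmean h).
by rewrite wnorm_cst ?l2norm_ge0//; under eq_fun do rewrite subrK.
Qed.

(** The lazy walk acts on each coordinate separately, so the scalar gap carries over with a constant
    that does not see [N]. *)
Lemma lazy_vector_gap h : vmean h = 0 ->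
  wnorm mu (fun u => l2norm (lazy h u)) <=
  (1 - eta / 2) * wnorm mu (fun u => l2norm (h u)).
Proof.
move=> h0; have lam0 : 0 <= 1 - eta / 2 by move: eta2; lra.
rewrite -ler_sqr ?nnegrE ?mulr_ge0 ?wnorm_ge0// exprMn !wnorm_l2norm_sqr mulr_sumr.
apply: ler_sum => i _; apply: le_trans (lazy_gap (b := fun u => h u i 0) _).
  rewrite le_eqVlt; apply/orP; left; apply/eqP.
  apply: eq_bigr => u _; congr (_ * _ ^+ 2); rewrite /lazy summxE.
  by apply: eq_bigr => v _; rewrite !mxE.
have := congr1 (fun x : 'cV_N => x i 0) h0; rewrite summxE mxE => h0i.
by rewrite -[RHS]h0i; apply: eq_bigr => u _; rewrite mxE.
Qed.

Variables (W : Omega -> Omega -> 'M[R]_N) (e : R).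
Hypothesis e0 : 0 <= e.
Hypothesis W1 : forall u v, op_le (W u v - 1%:M) e.
Hypothesis W2 : op_le (\sum_u \sum_v (mu u * p u v) *: (W u v - 1%:M)) (e ^+ 2).

Definition tilt h u : 'cV[R]_N :=
  \sum_v p u v *: (W u v *m (2^-1 *: (h u + h v))).

Let pert h u := \sum_v p u v *: ((W u v - 1%:M) *m (2^-1 *: (h u + h v))).

Let tiltE h u : tilt h u = lazy h u + pert h u.
Proof.
rewrite /tilt /lazy /pert -big_split; apply: eq_bigr => v _ /=.
by rewrite -scalerDr mulmxBl mul1mx addrCA subrr addr0.
Qed.

Let l2norm_mid (x y : 'cV[R]_N) :
  l2norm (2^-1 *: (x + y)) <= 2^-1 * (l2norm x + l2norm y).
Proof. by rewrite l2normZ ger0_norm// ler_wpM2l// l2normD. Qed.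

Let mid_shift (x y z : 'cV[R]_N) :
  2^-1 *: (x + y) = 2^-1 *: ((x - z) + (y - z)) + z.
Proof. by apply/matrixP => i j; rewrite !mxE; field. Qed.

Let pert_le h u :
  l2norm (pert h u) <= e * lazy ((fun v => l2norm (h v)) : Omega -> R^o) u.
Proof.
apply: le_trans (l2norm_sum _ _ _) _ => //.
rewrite mulr_sumr; apply: ler_sum => v _; rewrite /GRing.scale/= mulrCA.
rewrite ler_wpM2l//; apply: le_trans (W1 _ _ _) _.
by rewrite ler_wpM2l//; exact: l2norm_mid.
Qed.

Let wnorm_pert h :
  wnorm mu (fun u => l2norm (pert h u)) <= e * wnorm mu (fun u => l2norm (h u)).
Proof.
apply: (@le_trans _ _ (wnorm mu (fun u => e *
    lazy ((fun v => l2norm (h v)) : Omega -> R^o) u))).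
  by apply: ler_wnorm => // u; rewrite l2norm_ge0 pert_le.
rewrite wnormZ// ler_wpM2l// -ler_sqr ?nnegrE ?wnorm_ge0// !wnorm_sqr//.
exact: lazy_contraction.
Qed.

(** On the constant part of [h] the perturbation is averaged over a stationary edge and costs only
    [e^2] by [W2]; the fluctuation alone is charged the full [e]. *)
Lemma vmean_tilt h :
  l2norm (vmean (tilt h)) <= (1 + e ^+ 2) * l2norm (vmean h) + e * vdev h.
Proof.
pose b u := h u - vmean h.
have -> : vmean (tilt h) = vmean h +
    (\sum_u \sum_v (mu u * p u v) *: (W u v - 1%:M)) *m vmean h +
    \sum_u mu u *: pert b u.
  rewrite {1}/vmean; under eq_bigr do rewrite tiltE scalerDr.
  rewrite big_split/= mean_lazy -addrA; congr (_ + _).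
  rewrite mulmx_suml -big_split; apply: eq_bigr => u _ /=.
  rewrite mulmx_suml /pert !scaler_sumr -big_split; apply: eq_bigr => v _ /=.
  rewrite -scalemxAl !scalerA -scalerDr -mulmxDr; congr (_ *: (_ *m _)).
  by rewrite (mid_shift _ _ (vmean h)) addrC.
apply: le_trans (l2normD _ _) _; apply: lerD.
  by rewrite mulrDl mul1r; apply: le_trans (l2normD _ _) _; rewrite lerD2l.
apply: le_trans (l2norm_sum _ _ _) _ => //.
exact: le_trans (wnorm_mean _ _ _) (wnorm_pert _).
Qed.

Lemma vdev_tilt h :
  vdev (tilt h) <= (1 - eta / 2 + e) * vdev h + e * l2norm (vmean h).
Proof.
pose b u := h u - vmean h.
have lazyb u : lazy h u = lazy b u + vmean h.
  rewrite -[vmean h]scale1r -(p1 u) scaler_suml -big_split; apply: eq_bigr => v _ /=.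
  by rewrite -scalerDr; congr (_ *: _); exact: mid_shift.
have mb : vmean b = 0 by exact: vmean_dev.
have tE u : tilt h u - vmean (tilt h) = lazy b u + (pert h u - vmean (pert h)).
  have -> : vmean (tilt h) = vmean h + vmean (pert h).
    rewrite {1}/vmean; under eq_bigr do rewrite tiltE scalerDr.
    by rewrite big_split/= mean_lazy.
  by rewrite tiltE lazyb; apply/matrixP => i j; rewrite !mxE; ring.
rewrite /vdev; under eq_fun do rewrite tE.
apply: le_trans (wnorm_l2normD _ _) _.
rewrite mulrDl -addrA; apply: lerD; first exact: lazy_vector_gap.
rewrite -mulrDr; apply: le_trans (vdev_le _) _.
apply: le_trans (wnorm_pert _) _.
by rewrite ler_wpM2l// wnorm_le_vdev.
Qed.

Hypothesis eta0 : 0 < eta.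
Hypothesis e_eta : e <= eta / 4.

(** The mean and the deviation obey a coupled linear recursion. The ratio [4 e / eta] is its
    barrier: as [e <= eta / 4], the deviation contracts by [1 - eta / 4] and receives [e] times the
    mean, and [(1 - eta / 4) (4 e / eta) + e = 4 e / eta]. Fed back into the mean, it yields the
    term [4 e^2 / eta]. *)
Lemma vmean_iter_tilt n (x : 'cV[R]_N) : l2norm x = 1 ->
  l2norm (vmean (iter n tilt (fun=> x))) <= (1 + e ^+ 2 + 4 * e ^+ 2 / eta) ^+ n.
Proof.
move=> x1; set r := 1 + _ + _.
have er : 0 <= 4 * e / eta by rewrite !mulr_ge0 ?invr_ge0// ltW.
have r1 : 1 <= r.
  by rewrite /r -addrA lerDl addr_ge0 ?sqr_ge0// !mulr_ge0 ?sqr_ge0 ?invr_ge0// ltW.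
suff [] : l2norm (vmean (iter n tilt (fun=> x))) <= r ^+ n /\
  vdev (iter n tilt (fun=> x)) <= 4 * e / eta * r ^+ n by [].
elim: n => [|n [IHm IHd]] /=.
  have -> : vmean (fun=> x) = x by rewrite /vmean -scaler_suml mu1 scale1r.
  rewrite x1 expr0; split=> //; rewrite mulr1 /vdev.
  rewrite (_ : vmean _ = x) ?subrr ?l2norm0 ?wnorm_cst//.
  by rewrite /vmean -scaler_suml mu1 scale1r.
set h := iter n tilt _ in IHm IHd *.
have rn0 : 0 <= r ^+ n by rewrite exprn_ge0// (le_trans _ r1).
split.
  apply: le_trans (vmean_tilt _) _; rewrite (exprS r).
  have h1 : (1 + e ^+ 2) * l2norm (vmean h) <= (1 + e ^+ 2) * r ^+ n.
    by rewrite ler_wpM2l// addr_ge0 ?sqr_ge0.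
  have h2 : e * vdev h <= e * (4 * e / eta * r ^+ n) by rewrite ler_wpM2l.
  apply: le_trans (lerD h1 h2) _; rewrite le_eqVlt; apply/orP; left; apply/eqP.
  by move: (r ^+ n) => rn; rewrite /r; ring.
apply: le_trans (vdev_tilt _) _.
have h1 : (1 - eta / 2 + e) * vdev h <= (1 - eta / 4) * (4 * e / eta * r ^+ n).
  have := wnorm_ge0 mu (fun u => l2norm (h u - vmean h)); rewrite -/(vdev h) => d0.
  apply: (@le_trans _ _ ((1 - eta / 4) * vdev h)).
    by rewrite ler_wpM2r//; move: e_eta; lra.
  by rewrite ler_wpM2l//; move: eta2; lra.
have h2 : e * l2norm (vmean h) <= e * r ^+ n by rewrite ler_wpM2l.
apply: le_trans (lerD h1 h2) _.
apply: (@le_trans _ _ (4 * e / eta * r ^+ n)).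
  rewrite le_eqVlt; apply/orP; left; apply/eqP.
  move: (r ^+ n) => rn; field.
  by rewrite gt_eqF.
by rewrite ler_wpM2l// (exprS r) ler_peMl.
Qed.

End VectorValued.
End ReversibleKernel.

(** * Finite trajectories of a Markov chain and their probabilities *)

Definition traj (S T : Type) (X : nat -> T -> S) n w : seq S :=
  [seq X k w | k <- iota 0 n].

Section Trajectories.
Variable S : finType.

Fixpoint trajs n : seq (seq S) :=
  if n is n'.+1 then [seq a :: s | a <- enum S, s <- trajs n'] else [:: [::]].

Lemma mem_trajs n s : (s \in trajs n) = (size s == n).
Proof.
elim: n s => [|n IH] [|a s] //=.
  by apply/allpairsP => -[[b s'] [_ _]].
rewrite eqSS -IH; apply/allpairsP/idP => [[[b s'] [_ /= s'n [_ ->]]]//|sn].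
by exists (a, s); rewrite mem_enum.
Qed.

Lemma big_trajsS (V : nmodType) n (F : seq S -> V) :
  \sum_(s <- trajs n.+1) F s = \sum_a \sum_(s <- trajs n) F (a :: s).
Proof.
by rewrite /= big_allpairs_dep/= big_enum/=.
Qed.

Variables (R : realType) (init : S -> R) (q : S -> S -> R).

Fixpoint path_weight a s : R :=
  if s is b :: s' then q a b * path_weight b s' else 1.

Definition traj_weight s : R := if s is a :: s' then init a * path_weight a s' else 1.

Lemma path_weight_rcons a s b :
  path_weight a (rcons s b) = path_weight a s * q (last a s) b.
Proof.
by elim: s a => [|c s IH] a /=; rewrite ?mulr1 ?mul1r// IH mulrA.
Qed.

Hypotheses (init0 : forall a, 0 <= init a) (q0 : forall a b, 0 <= q a b).

Lemma path_weight_ge0 a s : 0 <= path_weight a s.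
Proof. by elim: s a => //= b s IH a; rewrite mulr_ge0. Qed.

Lemma traj_weight_ge0 s : 0 <= traj_weight s.
Proof. by case: s => //= a s; rewrite mulr_ge0// path_weight_ge0. Qed.

Variables (d : measure_display) (T : measurableType d) (Pr : probability T R).
Variable X : nat -> T -> S.
Hypothesis mX : is_markov_chain Pr init q X.

Local Notation traj := (traj X).

Lemma traj_cylinder a s :
  [set w | traj (size s).+1 w = a :: s] =
  [set w | forall k, (k <= size s)%N -> X k w = nth a (a :: s) k].
Proof.
apply/seteqP; split=> w /=.
  move=> h k ks; rewrite -h (nth_map 0%N) ?size_iota//.
  by rewrite nth_iota.
move=> h; apply: (@eq_from_nth _ a); first by rewrite size_map size_iota.
move=> k; rewrite size_map size_iota => ks.
by rewrite (nth_map 0%N) ?size_iota// nth_iota// h.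
Qed.

Lemma measurable_traj n s : measurable [set w | traj n w = s].
Proof.
have [ms _ _] := mX.
elim/last_ind: s n => [|s b IH] [|n].
- rewrite (_ : [set _ | _] = setT)//; exact/seteqP.
- by rewrite (_ : [set _ | _] = set0)//; apply/seteqP; split=> w //=.
- rewrite (_ : [set _ | _] = set0)//; apply/seteqP; split=> w //=.
  by move=> /(congr1 size); rewrite size_rcons.
rewrite (_ : [set _ | _] = [set w | traj n w = s] `&` [set w | X n w = b]).
  by apply: measurableI; [exact: IH|exact: ms].
apply/seteqP; split=> w /=; rewrite /traj -addn1 iotaD map_cat/= add0n cats1.
  by move=> /rcons_inj [].
by move=> [-> ->].
Qed.

Lemma prob_traj a s :
  Pr [set w | traj (size s).+1 w = a :: s] = (traj_weight (a :: s))%:E.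
Proof.
have [_ X0 XS] := mX; rewrite traj_cylinder.
elim/last_ind: s => [|s b IH].
  rewrite /= mulr1 -X0; congr (Pr _); apply/seteqP; split=> w /= h.
    exact: (h 0%N).
  by case.
(* The Markov property takes an infinite sequence of states; [nth] pads the finite one with [a], and
   only the entries up to [(size s).+1] are read. *)
rewrite size_rcons (XS (size s) (nth a (a :: rcons s b))).
rewrite [traj_weight _]/= path_weight_rcons mulrA.
rewrite [nth a _ (size s).+1]/= nth_rcons ltnn eqxx.
have -> : nth a (a :: rcons s b) (size s) = last a s.
  rewrite -rcons_cons nth_rcons /= ltnSn.
  by rewrite (last_nth a).
rewrite EFinM -IH; congr (Pr _ * _)%E; apply/seteqP.
by split=> w /= h k ks; rewrite (h k ks) -rcons_cons nth_rcons /= ltnS ks.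
Qed.

Lemma traj_pred_bigsetU n (Q : pred (seq S)) : [set w | Q (traj n w)] =
  \big[setU/set0]_(s <- trajs n | Q s) [set w | traj n w = s].
Proof.
rewrite -bigcup_seq_cond; apply/seteqP; split=> [w Qw|w [s /= /andP[_ Qs] ->]//].
exists (traj n w) => //; apply/andP; split=> //.
by rewrite mem_trajs size_map size_iota.
Qed.

Lemma measurable_traj_pred n (Q : pred (seq S)) :
  measurable [set w | Q (traj n w)].
Proof.
rewrite traj_pred_bigsetU.
by apply: bigsetU_measurable => s _; exact: measurable_traj.
Qed.

Lemma prob_traj_le n (Q : pred (seq S)) :
  (Pr [set w | Q (traj n.+1 w)] <=
   (\sum_(s <- trajs n.+1 | Q s) traj_weight s)%:E)%E.
Proof.
rewrite traj_pred_bigsetU.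
have : forall s, s \in trajs n.+1 -> Pr [set w | traj n.+1 w = s] = (traj_weight s)%:E.
  move=> [|a s]; rewrite mem_trajs//= eqSS => /eqP <-; exact: prob_traj.
elim: (trajs n.+1) => [|s r IH] h.
  by rewrite !big_nil measure0.
have {}IH := IH (fun s' rs' => h s' (mem_behead (s := s :: r) rs')).
rewrite !big_cons; case: ifP => // _.
apply: le_trans (measureU2 _ _ _) _.
- exact: measurable_traj.
- by apply: bigsetU_measurable => s' _; exact: measurable_traj.
rewrite EFinD; apply: leeD => //.
by move: (h s (mem_head s r)) => /= ->.
Qed.

End Trajectories.

(** * Expected ordered products along the symmetric chain *)

Section SymmetricChainMoments.
Variables (R : realType) (Omega : finType) (p : Omega -> Omega -> R).

Lemma sum_sym_jump (V : lmodType R) w (G : sym_pair Omega -> V) :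
  \sum_b sym_jump p w b *: G b = \sum_v p w v *: G (sym_class w v).
Proof.
rewrite [RHS](partition_big (sym_class w) xpredT)//=; apply: eq_bigr => b _.
by rewrite /sym_jump scaler_suml; apply: eq_bigr => v /eqP ->.
Qed.

Lemma sum_sym_init (V : lmodType R) (mu : Omega -> R) (G : sym_pair Omega -> V) :
  \sum_a sym_init mu p a *: G a =
  \sum_u mu u *: \sum_v p u v *: G (sym_class u v).
Proof.
have e a : sym_init mu p a *: G a = \sum_u mu u *: (sym_jump p u a *: G a).
  rewrite scaler_suml; apply: eq_bigr => u _.
  by rewrite scalerA /sym_jump mulr_sumr.
under eq_bigr do rewrite e.
rewrite exchange_big; apply: eq_bigr => u _.
by rewrite -scaler_sumr sum_sym_jump.
Qed.

Section Product.
Variables (N : nat) (W : sym_pair Omega -> 'M[R]_N) (x : 'cV[R]_N).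

Definition mxprod (s : seq (sym_pair Omega)) : 'M[R]_N :=
  foldr (fun a M => W a *m M) 1%:M s.

Let g n := iter n (tilt p (fun u v => W (sym_class u v))) (fun=> x).

(** Given the first pair, the law of the future depends only on the end chosen by the fair coin.
    Hence a function [g] on vertices suffices, averaged over the two ends, although the chain lives
    on pairs. *)
Lemma path_expectation n a :
  \sum_(s <- trajs _ n) path_weight (sym_trans p) a s *: (mxprod (a :: s) *m x) =
  W a *m (2^-1 *: (g n (repr a).1 + g n (repr a).2)).
Proof.
elim: n a => [|n IH] a.
  rewrite big_seq1 scale1r /= mulmx1; congr (_ *m _).
  by apply/matrixP => i j; rewrite !mxE; field.
have gS w : \sum_b sym_jump p w b *:
    (W b *m (2^-1 *: (g n (repr b).1 + g n (repr b).2))) = g n.+1 w.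
  rewrite sum_sym_jump /g /= {3}/tilt; apply: eq_bigr => v _.
  congr (_ *: (_ *m (_ *: _))).
  by case: (repr_sym_class w v) => -> //=; rewrite addrC.
rewrite big_trajsS -!gS -big_split /= scaler_sumr mulmx_sumr.
apply: eq_bigr => b _.
transitivity (sym_trans p a b *: (W a *m
    \sum_(s <- trajs _ n) path_weight (sym_trans p) b s *: (mxprod (b :: s) *m x))).
  rewrite mulmx_sumr scaler_sumr; apply: eq_bigr => s _ /=.
  by rewrite -scalemxAr scalerA !mulmxA.
rewrite IH /sym_trans -mulrDr -scalerDl scalerA [in RHS]addrC.
by move: (W b *m _) => y; rewrite -scalemxAr.
Qed.

(** The initial pair is itself an edge drawn from its first vertex, so [n.+1] states correspond to
    [n.+1] applications of the tilted kernel. *)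
Lemma traj_expectation (mu : Omega -> R) n :
  \sum_(s <- trajs _ n.+1)
    traj_weight (sym_init mu p) (sym_trans p) s *: (mxprod s *m x) =
  \sum_u mu u *: g n.+1 u.
Proof.
rewrite big_trajsS.
transitivity (\sum_a sym_init mu p a *:
    (W a *m (2^-1 *: (g n (repr a).1 + g n (repr a).2)))).
  apply: eq_bigr => a _; rewrite -path_expectation scaler_sumr.
  by apply: eq_bigr => s _; rewrite scalerA.
rewrite sum_sym_init; apply: eq_bigr => u _; congr (_ *: _).
rewrite /g /= {3}/tilt; apply: eq_bigr => v _.
congr (_ *: (_ *m (_ *: _))).
by case: (repr_sym_class u v) => -> //=; rewrite addrC.
Qed.

End Product.

Section UnipotentProduct.
Variables (n : nat) (z : sym_pair Omega -> 'cV[R]_n) (m : nat).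

Lemma mxprod_tpow_unip s :
  mxprod (fun a => tpow (unip (z a)) m) s = tpow (unip (\sum_(a <- s) z a)) m.
Proof.
elim: s => [|a s IH] /=; first by rewrite big_nil unip0 tpow1.
by rewrite IH -tpowM unipM big_cons.
Qed.

Let i0 : 'I_(1 + (n + 1)) := lshift _ 0.
Let j0 : 'I_(1 + (n + 1)) := rshift 1 (rshift n 0).

(** The left side is one coordinate of the expected product applied to a basis vector, since the
    corner entry of the tensor power is the [m]-th power of the squared norm; a coordinate is at
    most the norm. *)
Lemma traj_moment (mu : Omega -> R) k :
  \sum_(s <- trajs _ k.+1) traj_weight (sym_init mu p) (sym_trans p) s *
    (l2norm (\sum_(a <- s) z a) ^+ 2) ^+ m <=
  l2norm (vmean mu (iter k.+1
    (tilt p (fun u v => tpow (unip (z (sym_class u v))) m))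
    (fun=> delta_mx (tidx j0 m) 0))).
Proof.
apply: le_trans (coord_le_l2norm _ (tidx i0 m)).
rewrite /vmean -(traj_expectation (fun a => tpow (unip (z a)) m)) summxE.
rewrite le_eqVlt; apply/orP; left; apply/eqP; apply: eq_bigr => s _.
rewrite mxE mxprod_tpow_unip; congr (_ * _).
by rewrite -colE mxE tpowE unipE.
Qed.

End UnipotentProduct.
End SymmetricChainMoments.

(** * The Frobenius norm as a Euclidean norm *)

Section Frobenius.
Variable R : realType.

Definition fvec n (Y : 'M[R]_n) : 'cV[R]_(n * n) := (mxvec Y)^T.

Lemma fvec_is_linear n : linear (@fvec n).
Proof. by move=> a A B; rewrite /fvec !linearP. Qed.

HB.instance Definition _ n :=
  GRing.isLinear.Build R 'M[R]_n 'cV[R]_(n * n) *:%R (@fvec n) (@fvec_is_linear n).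

Lemma l2norm_fvec_sqr n (Y : 'M[R]_n) :
  l2norm (fvec Y) ^+ 2 = \sum_i \sum_j Y i j ^+ 2.
Proof.
rewrite l2norm_sqr pair_big (reindex _ (curry_mxvec_bij _ _)) /=.
by apply: eq_bigr => -[i j] _ /=; rewrite mxE mxvecE.
Qed.

Lemma opnorm_le_fvec n (Y : 'M[R]_n) : opnorm Y <= l2norm (fvec Y).
Proof.
apply: ge_sup; first by exists (l2norm (Y *m 0)); exists 0 => //=; rewrite l2norm0.
move=> _ [x /= x1 <-].
have Yf : op_le Y (l2norm (fvec Y)).
  apply: op_le_sqr => [|{x1}x]; first exact: l2norm_ge0.
  rewrite l2norm_fvec_sqr l2norm_sqr mulr_suml; apply: ler_sum => i _.
  have := dot_le_l2norm (row i Y)^T x; rewrite trmxK -row_mul mxE.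
  by rewrite [l2norm (row i Y)^T ^+ 2]l2norm_sqr; under eq_bigr do rewrite !mxE.
by apply: le_trans (Yf x) _; rewrite ler_piMr ?l2norm_ge0.
Qed.

Lemma fvec_F_sym (Omega : finType) (a : sym_pair Omega) :
  l2norm (fvec (F_sym R a)) <= 1.
Proof.
have E1 (u v : Omega) : l2norm (fvec (E_mx R u v)) = 1.
  by rewrite /fvec /E_mx mxvec_delta trmx_delta l2norm_delta.
rewrite /F_sym linearZ/= linearD l2normZ ger0_norm//.
rewrite -ler_pdivlMl// invrK mulr1; apply: le_trans (l2normD _ _) _.
by rewrite !E1.
Qed.

End Frobenius.

(** * The spectral gap, the density ratio and the stationary mean *)

Section Gap.
Variables (R : realType) (Omega : finType) (p : Omega -> Omega -> R).
Variable mu : Omega -> R.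
Hypotheses (tp : is_transition p) (dmu : is_distribution mu).
Hypothesis rev : is_reversible p mu.

(** Some [u] has positive mass, and [mu P^k = mu] carries part of it to [v]. *)
Lemma invariant_gt0 : is_irreducible p -> is_invariant p mu -> forall v, 0 < mu v.
Proof.
move=> irr inv v.
have [u u0] : exists u, 0 < mu u.
  apply: contrapT => /forallNP h; have := dmu.2; rewrite big1 => [|u _].
    by move/eqP; rewrite eq_sym oner_eq0.
  by apply/eqP; rewrite eq_le dmu.1 andbT leNgt; apply/negP; exact: h.
have [k] := irr u v; set P := kernel_mx p.
pose m : 'rV[R]_#|Omega| := \row_i mu (enum_val i).
have mP : m *m P = m.
  apply/rowP => j; rewrite !mxE -[RHS]inv (reindex (@enum_val Omega predT)) /=.
    by apply: eq_bigr => i _; rewrite !mxE.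
  by apply: onW_bij; exact: enum_val_bij.
have mPk : m *m (P ^+ k) = m.
  elim: k => [|k IH]; first by rewrite expr0 mulmx1.
  by rewrite exprSr -mulmxE mulmxA IH.
have Pk0 i j : 0 <= (P ^+ k) i j.
  elim: k {mPk} i j => [|k IH] i j; first by rewrite expr0 !mxE ler0n.
  rewrite exprSr -mulmxE mxE; apply: sumr_ge0 => l _.
  by rewrite mulr_ge0// mxE; exact: (tp _).1.
move=> Puv; have := congr1 (fun x : 'rV_ _ => x 0 (enum_rank v)) mPk.
rewrite !mxE enum_rankK => <-; rewrite (bigD1 (enum_rank u))//=.
rewrite ltr_wpDr// ?sumr_ge0// => [i _|].
  by rewrite mulr_ge0// mxE dmu.1.
by rewrite mulr_gt0// mxE enum_rankK.
Qed.

(** [2 |h u h v| <= h u ^ 2 + h v ^ 2] on a stationary edge. This bounds the Rayleigh quotients, so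
    that the supremum in the gap is a genuine one, and yields both bounds on the gap. *)
Lemma inner_kernel_bound h :
  `|inner mu h (kernel_act p h)| <= inner mu h h.
Proof.
have -> : inner mu h (kernel_act p h) = \sum_u \sum_v (mu u * p u v) * (h u * h v).
  apply: eq_bigr => u _; rewrite /kernel_act mulr_sumr; apply: eq_bigr => v _; ring.
have -> : inner mu h h = \sum_u \sum_v (mu u * p u v) * (2^-1 * (h u ^+ 2 + h v ^+ 2)).
  have := sum_edge_mid tp rev (fun u => h u ^+ 2 : R^o); rewrite /GRing.scale/= => ->.
  by apply: eq_bigr => u _; rewrite expr2 mulrA.
apply: le_trans (ler_norm_sum _ _ _) _; apply: ler_sum => u _.
apply: le_trans (ler_norm_sum _ _ _) _; apply: ler_sum => v _.
have pi0 : 0 <= mu u * p u v by rewrite mulr_ge0 ?dmu.1//; exact: (tp _).1.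
rewrite normrM (ger0_norm pi0) ler_wpM2l//.
have := sqr_ge0 (h u - h v); have := sqr_ge0 (h u + h v).
by rewrite ler_norml => ? ?; apply/andP; split; nra.
Qed.

Hypothesis mu_gt0 : forall u, 0 < mu u.

Lemma inner_gt0 h : (exists u, h u != 0) -> 0 < inner mu h h.
Proof.
move=> [u u0]; rewrite /inner (bigD1 u)//= ltr_wpDr//.
  by apply: sumr_ge0 => v _; rewrite -mulrA mulr_ge0// -?expr2 ?sqr_ge0// ltW.
by rewrite -mulrA -expr2 mulr_gt0// exprn_even_gt0.
Qed.

Let Rayleigh := [set inner mu h (kernel_act p h) / inner mu h h |
  h in [set h : Omega -> R | (exists u, h u != 0) /\ \sum_u mu u * h u = 0]].

Let Rayleigh_le1 : ubound Rayleigh 1.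
Proof.
move=> _ [h [h0 _] <-]; rewrite ler_pdivrMr ?inner_gt0// mul1r.
exact: le_trans (ler_norm _) (inner_kernel_bound h).
Qed.

Let Rayleigh_le_sup x : Rayleigh x -> x <= 1 - spectral_gap p mu.
Proof.
rewrite /spectral_gap opprD addNKr opprK; apply: ub_le_sup.
by exists 1.
Qed.

Lemma spectral_gapP h : \sum_u mu u * h u = 0 ->
  inner mu h (kernel_act p h) <= (1 - spectral_gap p mu) * inner mu h h.
Proof.
move=> h0; have [hn0|] := pselect (exists u, h u != 0).
  by rewrite -ler_pdivrMr ?inner_gt0//; apply: Rayleigh_le_sup; exists h.
move=> /forallNP hz; have {}hz u : h u = 0 by apply/eqP/negPn/negP/hz.
rewrite /inner !big1 ?mulr0// => u _; by rewrite !hz ?mulr0 ?mul0r.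
Qed.

Lemma spectral_gap_bounds : (2 <= #|Omega|)%N -> 0 <= spectral_gap p mu <= 2.
Proof.
move=> card2; have [u [v [_ _ uv]]] : exists u v, [/\ u \in Omega, v \in Omega & u != v].
  exact/card_gt1P.
(* A mean-zero function on two states makes the set of Rayleigh quotients nonempty; [sup] of an
   empty set would be a default value. *)
pose h w := (w == u)%:R * mu v - (w == v)%:R * mu u.
have hn0 : exists w, h w != 0.
  by exists u; rewrite /h eqxx (negbTE uv) mul1r mul0r subr0 gt_eqF.
have h0 : \sum_w mu w * h w = 0.
  rewrite (bigD1 u)//= (bigD1 v)/=; last by rewrite eq_sym.
  rewrite big1 => [|w /andP[wu wv]]; last first.
    by rewrite /h (negbTE wu) (negbTE wv) !mul0r subrr mulr0.
  rewrite /h !eqxx (negbTE uv) (eq_sym v) (negbTE uv) !(mul1r, mul0r) subr0 sub0r addr0.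
  by rewrite mulrN mulrC subrr.
have hR : Rayleigh (inner mu h (kernel_act p h) / inner mu h h) by exists h.
apply/andP; split.
  by rewrite subr_ge0; apply: ge_sup => //; eexists; exact: hR.
have := Rayleigh_le_sup hR.
have : -1 <= inner mu h (kernel_act p h) / inner mu h h.
  rewrite ler_pdivlMr ?inner_gt0// mulN1r.
  by have := inner_kernel_bound h; rewrite ler_norml => /andP[].
lra.
Qed.

Lemma le_ratio_sup nu u : nu u <= ratio_sup nu mu * mu u.
Proof. by rewrite -ler_pdivrMr//; apply: le_bigmax. Qed.

Lemma ratio_sup_ge1 nu : is_distribution nu -> 1 <= ratio_sup nu mu.
Proof.
move=> [_ <-]; rewrite -[leRHS]mulr1 -dmu.2 mulr_sumr.
by apply: ler_sum => u _; exact: le_ratio_sup.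
Qed.

(** Reversibility makes a stationary edge exchangeable, so symmetrizing the counting matrix leaves
    its mean unchanged. *)
Lemma sym_mean :
  \sum_u \sum_v (mu u * p u v) *: F_sym R (sym_class u v) = D_mx mu *m kernel_mx p.
Proof.
under eq_bigr => u _ do under eq_bigr => v _ do rewrite F_sym_class.
have EE : \sum_u \sum_v (mu u * p u v) *: E_mx R u v = D_mx mu *m kernel_mx p.
  rewrite [RHS]matrix_sum_delta.
  rewrite [RHS](reindex (@enum_rank Omega))/=; last exact/onW_bij/enum_rank_bij.
  apply: eq_bigr => u _.
  rewrite [RHS](reindex (@enum_rank Omega))/=; last exact/onW_bij/enum_rank_bij.
  by apply: eq_bigr => v _; rewrite /D_mx mul_diag_mx !mxE !enum_rankK.
transitivity (2^-1 *: (\sum_u \sum_v (mu u * p u v) *: E_mx R u v +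
    \sum_u \sum_v (mu u * p u v) *: E_mx R v u)).
  rewrite -big_split /= scaler_sumr; apply: eq_bigr => u _ /=.
  rewrite -big_split /= scaler_sumr; apply: eq_bigr => v _ /=.
  by rewrite -scalerDr !scalerA mulrC.
rewrite -(reversible_swap rev (fun u v => E_mx R u v)) EE scalerDr -scalerDl.
by rewrite -[2^-1]mul1r -splitr scale1r.
Qed.

Lemma sum_edge1 : \sum_(e : Omega * Omega) mu e.1 * p e.1 e.2 = 1.
Proof.
rewrite -(pair_bigA _ (fun u v => mu u * p u v)) /= -dmu.2.
by apply: eq_bigr => u _; rewrite -mulr_sumr (tp u).2 mulr1.
Qed.

Lemma fvec_mean : l2norm (fvec (D_mx mu *m kernel_mx p)) <= 1.
Proof.
rewrite -sym_mean (pair_bigA _ (fun u v => _ *: F_sym R (sym_class u v)))/=.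
rewrite linear_sum; under eq_bigr do rewrite linearZ/=.
apply: le_trans (l2norm_sum _ _ _) _.
  by move=> e _; rewrite mulr_ge0 ?dmu.1//; exact: (tp _).1.
rewrite -[leRHS]sum_edge1; apply: ler_sum => e _; rewrite ler_piMr ?fvec_F_sym//.
by rewrite mulr_ge0 ?dmu.1//; exact: (tp _).1.
Qed.

End Gap.

(** [864 = 144 * 2 + 576] comes from [e^2 + 4 e^2 / eta] with [e = 12 m / r] and [eta <= 2]; the
    factor [expR 2] makes Markov's inequality gain [expR (2 m)] against a moment of at most
    [expR m]. *)
Definition tail_cst (R : realType) : R := 864 * expR 2.

Lemma tail_cst_gt0 (R : realType) : 0 < tail_cst R.
Proof. by apply: mulr_gt0; [rewrite ltr0n|exact: expR_gt0]. Qed.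

(** * Moments and tail of the centered sum under trajectory weights *)

Section Concentration.
Variables (R : realType) (Omega : finType) (p : Omega -> Omega -> R).
Variable mu : Omega -> R.
Hypotheses (tp : is_transition p) (dmu : is_distribution mu).
Hypothesis rev : is_reversible p mu.
Hypothesis mu_gt0 : forall u, 0 < mu u.
Hypothesis card2 : (2 <= #|Omega|)%N.

Local Notation eta := (spectral_gap p mu).
Local Notation M := (D_mx mu *m kernel_mx p).
Local Notation weight nu := (traj_weight (sym_init nu p) (sym_trans p)).

Hypothesis eta_gt0 : 0 < eta.

Let mu0 u : 0 <= mu u. Proof. exact: dmu.1. Qed.
Let pi0 u v : 0 <= mu u * p u v.
Proof. by rewrite mulr_ge0//; exact: (tp u).1. Qed.

Definition centered (r : R) (a : sym_pair Omega) : 'cV[R]_(#|Omega| * #|Omega|) :=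
  r^-1 *: fvec (F_sym R a - M).

Lemma l2norm_centered r a : 0 < r -> l2norm (centered r a) <= 2 / r.
Proof.
move=> r0; have r_ge0 := ltW r0.
rewrite /centered l2normZ ger0_norm ?invr_ge0// [_ * l2norm _]mulrC.
rewrite ler_pM2r ?invr_gt0// linearB; apply: le_trans (l2normB _ _) _.
by rewrite (_ : 2 = 1 + 1 :> R)// lerD ?fvec_F_sym ?fvec_mean.
Qed.

Lemma mean_centered r :
  \sum_u \sum_v (mu u * p u v) *: centered r (sym_class u v) = 0.
Proof.
rewrite (pair_bigA _ (fun u v => _ *: centered r (sym_class u v)))/=.
have e c a : c *: centered r a = r^-1 *: fvec (c *: (F_sym R a - M)).
  by rewrite /centered [fvec (c *: _)]linearZ/= !scalerA mulrC.
under eq_bigr do rewrite e.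
rewrite -scaler_sumr -linear_sum/=; under eq_bigr do rewrite scalerBr.
rewrite sumrB -scaler_suml (sum_edge1 tp dmu) scale1r.
rewrite -(pair_bigA _ (fun u v => (mu u * p u v) *: F_sym R (sym_class u v)))/=.
by rewrite (sym_mean rev) subrr linear0 scaler0.
Qed.

(** The size [12 m / r] is the product of [2 / r] for a centered summand, 3 for its unipotent matrix
    and [2 m] for the tensor power. Being at most [eta / 4 <= 1 / 2], it also ensures the smallness
    conditions of these bounds. *)
Lemma centered_moment r m n : 0 < r -> (0 < m)%N ->
  12 * m%:R / r <= eta / 4 ->
  \sum_(s <- trajs _ n.+1)
    weight mu s * (l2norm (\sum_(a <- s) centered r a) ^+ 2) ^+ m <=
  (1 + (12 * m%:R / r) ^+ 2 + 4 * (12 * m%:R / r) ^+ 2 / eta) ^+ n.+1.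
Proof.
move=> r0 m0 e_eta; apply: le_trans (traj_moment _ _ _ _ _) _.
have /andP[_ eta2] := spectral_gap_bounds tp dmu rev mu_gt0 card2.
have mr : 12 * m%:R / r <= 2^-1 by move: e_eta eta2; lra.
have r2 : 2 / r <= 1.
  apply: (@le_trans _ _ (12 * m%:R / r)); last by move: mr; lra.
  rewrite ler_wpM2r ?invr_ge0 ?(ltW r0)//.
  have : 1 <= m%:R :> R by rewrite ler1n.
  lra.
have ma1 : m%:R * (3 * (2 / r)) <= 1 by move: mr; lra.
have rge0 : 0 <= 3 * (2 / r) by rewrite mulr_ge0// divr_ge0// ltW.
have eE : 12 * m%:R / r = 2 * m%:R * (3 * (2 / r)) by ring.
rewrite eE; set e := 2 * _ * _.
have e0 : 0 <= e by rewrite /e mulr_ge0// mulr_ge0.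
apply: (vmean_iter_tilt tp dmu rev (spectral_gapP tp dmu rev mu_gt0)) => //.
- by move=> u v; apply: tpow_sub1_le => //; apply: unip_sub1 => //; exact: l2norm_centered.
(* The linear terms may be subtracted freely: by linearity their stationary mean is the derivative
   in the direction of the mean summand, which is 0. Only second-order terms remain. *)
- rewrite (_ : \sum_u _ = \sum_(uv : Omega * Omega) (mu uv.1 * p uv.1 uv.2) *:
      (tpow (unip (centered r (sym_class uv.1 uv.2))) m - 1%:M -
       tder (unip_gen (centered r (sym_class uv.1 uv.2))) m)).
    apply: op_le_sum => [uv||uv]; [exact: pi0|exact: sum_edge1|].
    apply: tpow_sub2_le => //; first by apply: unip_sub1 => //; exact: l2norm_centered.
    by apply: unip_sub2 => //; exact: l2norm_centered.
  under [RHS]eq_bigr do rewrite scalerBr.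
  rewrite sumrB tder_sum unip_gen_sum.
  have := mean_centered r.
  rewrite (pair_bigA _ (fun u v => _ *: centered r (sym_class u v)))/= => ->.
  rewrite unip_gen0 tder0 subr0.
  by rewrite (pair_bigA _ (fun u v => _ *: (tpow (unip (centered r (sym_class u v))) m - _)))/=.
- by rewrite /e -eE.
- exact: l2norm_delta.
Qed.

Let jump0 w b : 0 <= sym_jump p w b.
Proof. by apply: sumr_ge0 => v _; exact: (tp w).1. Qed.

Let trans0 a b : 0 <= sym_trans p a b.
Proof. exact: (sym_trans_distribution a tp).1. Qed.

(** The starting law enters linearly, through the first vertex only, so a change of start costs a
    single density factor. *)
Lemma weight_le_ratio nu s : is_distribution nu ->
  weight nu s <= ratio_sup nu mu * weight mu s.
Proof.
move=> dnu; case: s => [|a s] /=; first by rewrite mulr1 ratio_sup_ge1.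
rewrite mulrA ler_wpM2r ?path_weight_ge0// /sym_init mulr_sumr.
apply: ler_sum => u _; rewrite mulr_sumr; apply: ler_sum => v _.
by rewrite mulrA ler_wpM2r ?le_ratio_sup//; exact: (tp u).1.
Qed.

Definition deviation (s : seq (sym_pair Omega)) : R :=
  l2norm (fvec ((size s)%:R^-1 *: \sum_(a <- s) F_sym R a - M)).

(** It empties the tail event for [t > 2]; for [t <= 2] the moment order stays within a multiple of
    [n eta]. *)
Lemma deviation_le2 s : deviation s <= 2.
Proof.
rewrite /deviation linearB; apply: le_trans (l2normB _ _) _.
rewrite (_ : 2 = 1 + 1 :> R)// lerD ?fvec_mean//.
rewrite linearZ/= l2normZ ger0_norm ?invr_ge0// linear_sum.
have [->|s0] := posnP (size s); first by rewrite invr0 mul0r.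
rewrite ler_pdivrMl ?ltr0n// mulr1.
have := @l2norm_sum R _ _ s xpredT (fun=> 1) (fun a => fvec (F_sym R a))
  (fun _ _ => ler01).
under eq_bigr do rewrite scale1r.
move=> /le_trans; apply; rewrite -sum1_size natr_sum.
by apply: ler_sum => a _; rewrite mul1r fvec_F_sym.
Qed.

Lemma deviation_centered r s : 0 < r -> (0 < size s)%N ->
  deviation s = r / (size s)%:R * l2norm (\sum_(a <- s) centered r a).
Proof.
move=> r0 s0; have n0 : (size s)%:R != 0 :> R by rewrite pnatr_eq0 -lt0n.
have -> : \sum_(a <- s) centered r a =
    ((size s)%:R / r) *: fvec ((size s)%:R^-1 *: \sum_(a <- s) F_sym R a - M).
  rewrite /centered -scaler_sumr -linear_sum sumrB/= big_const_seq count_predT.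
  rewrite iter_addr_0 [_ / r]mulrC -scalerA; congr (_ *: _).
  rewrite -[RHS]linearZ/= scalerBr [_ *: (_ *: _)]scalerA.
  by rewrite mulfV// scale1r scaler_nat.
rewrite l2normZ ger0_norm ?divr_ge0 ?(ltW r0)// mulrA.
rewrite (_ : r / _ * _ = 1) ?mul1r//; field.
by rewrite n0 gt_eqF.
Qed.

(* Markov's inequality for the moment of order [2 m], with [r] chosen such that
   the bound of [centered_moment] is at most [expR m]. *)
Lemma deviation_weight n m t : (0 < m)%N -> 0 < t -> t <= 2 ->
  tail_cst R * m%:R <= eta * n.+1%:R * t ^+ 2 ->
  \sum_(s <- trajs _ n.+1 | t <= deviation s) weight mu s <= expR (- m%:R).
Proof.
move=> m0 t0 t2; rewrite /tail_cst.
have [K K0 KE] : exists2 K : R, 0 < K & K = 864 by exists 864; [rewrite ltr0n|].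
rewrite -KE => hm.
have mR : 0 < m%:R :> R by rewrite ltr0n.
have nR : 0 < n.+1%:R :> R by rewrite ltr0n.
set N : R := n.+1%:R in hm nR *.
pose r := Num.sqrt (K * N * m%:R / eta).
have q0 : 0 < K * N * m%:R / eta by rewrite divr_gt0// !mulr_gt0.
have r0 : 0 < r by rewrite sqrtr_gt0.
have r2 : r ^+ 2 = K * N * m%:R / eta by rewrite sqr_sqrtr// ltW.
have /andP[_ eta2] := spectral_gap_bounds tp dmu rev mu_gt0 card2.
set e := 12 * m%:R / r.
have e0 : 0 <= e by rewrite divr_ge0 ?mulr_ge0 ?ltW.
have e2 : e ^+ 2 = 144 * (m%:R * eta) / (K * N).
  rewrite /e expr_div_n r2; field.
  by rewrite !gt_eqF.
(* Here [t <= 2] enters: it gives [K m <= 4 eta N], while the claim amounts to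
   [144 * 16 * m <= K eta N]. *)
have e_eta : e <= eta / 4.
  rewrite -ler_sqr ?nnegrE//; last by rewrite divr_ge0// ltW.
  rewrite e2.
  rewrite ler_pdivrMr ?mulr_gt0//.
  have h1 : K * m%:R <= K * expR 2 * m%:R.
    by rewrite ler_wpM2r// ler_peMr ?(ltW K0)// -expR0 ler_expR.
  have h2 : eta * N * t ^+ 2 <= eta * N * 2 ^+ 2.
    by rewrite ler_wpM2l ?mulr_ge0 ?(ltW eta_gt0)// ler_sqr ?nnegrE ?(ltW t0).
  have h3 : K * m%:R * eta <= eta * N * 2 ^+ 2 * eta.
    by rewrite ler_wpM2r ?(ltW eta_gt0)//; apply: le_trans h1 (le_trans hm h2).
  have h4 : 0 < eta ^+ 2 * N by rewrite mulr_gt0// exprn_gt0.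
  by move: h3 h4; rewrite KE; lra.
pose D := (N * t / r) ^+ 2.
have D0 : 0 < D by rewrite exprn_gt0// divr_gt0// mulr_gt0.
have DE : D = eta * N * t ^+ 2 / (K * m%:R).
  by rewrite /D expr_div_n r2; field; rewrite !gt_eqF.
have De : expR 2 <= D.
  by rewrite DE ler_pdivlMr ?mulr_gt0//; move: hm; lra.
have wt0 s : 0 <= weight mu s.
  apply: traj_weight_ge0 => // a; exact: (sym_init_distribution dmu tp).1.
have : \sum_(s <- trajs _ n.+1 | t <= deviation s) D ^+ m * weight mu s <= expR m%:R.
  apply: (@le_trans _ _ (\sum_(s <- trajs _ n.+1)
      weight mu s * (l2norm (\sum_(a <- s) centered r a) ^+ 2) ^+ m)).
    rewrite big_mkcond !big_seq; apply: ler_sum => s; rewrite mem_trajs => /eqP sn.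
    have l0 := l2norm_ge0 (\sum_(a <- s) centered r a).
    case: ifP => [ts|_]; last by rewrite mulr_ge0// exprn_ge0// sqr_ge0.
    rewrite mulrC ler_wpM2l//; apply: lerXn2r; rewrite ?nnegrE ?sqr_ge0//.
    rewrite /D ler_sqr ?nnegrE ?divr_ge0 ?mulr_ge0 ?(ltW t0) ?(ltW r0)//.
    rewrite ler_pdivrMr// -ler_pdivlMl//.
    move: ts; rewrite (deviation_centered r0) ?sn// => /le_trans; apply.
    rewrite le_eqVlt; apply/orP; left; apply/eqP; rewrite -/N; ring.
  apply: le_trans (centered_moment _ r0 m0 e_eta) _; rewrite -/e.
  have rho : 1 + e ^+ 2 + 4 * e ^+ 2 / eta <= expR (m%:R / N).
    apply: le_trans (expR_ge1Dx _); rewrite -addrA lerD2l.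
    have -> : e ^+ 2 + 4 * e ^+ 2 / eta = (144 * (m%:R * eta) + 576 * m%:R) / (K * N).
      by rewrite e2; field; rewrite !gt_eqF.
    rewrite ler_pdivrMr ?mulr_gt0//.
    rewrite (_ : m%:R / N * (K * N) = K * m%:R); last by field; rewrite gt_eqF.
    have : m%:R * eta <= m%:R * 2 by rewrite ler_wpM2l// ltW.
    by rewrite KE; lra.
  apply: (@le_trans _ _ (expR (m%:R / N) ^+ n.+1)).
    apply: lerXn2r rho; rewrite nnegrE ?expR_ge0//.
    by rewrite addr_ge0 ?addr_ge0 ?sqr_ge0// divr_ge0 ?(ltW eta_gt0)// mulr_ge0 ?sqr_ge0.
  rewrite -expRM_natl -/N.
  by rewrite mulrCA mulfV ?gt_eqF// mulr1.
rewrite -mulr_sumr -ler_pdivlMl ?(exprn_gt0 m D0)// => /le_trans; apply.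
have : (expR 2) ^+ m <= D ^+ m by apply: lerXn2r; rewrite ?nnegrE ?expR_ge0// ltW.
rewrite -expRM_natl => h.
apply: (@le_trans _ _ ((expR (m%:R * 2))^-1 * expR m%:R)).
  by rewrite ler_wpM2r ?expR_ge0// lef_pV2 ?posrE ?expR_gt0//; exact: exprn_gt0.
rewrite -expRN -expRD le_eqVlt; apply/orP; left; apply/eqP; congr expR; ring.
Qed.

End Concentration.

(** * From trajectory weights to probabilities *)

Lemma sym_counting_traj (R : realType) (Omega : finType) (T : Type)
    (U : nat -> T -> sym_pair Omega) n w :
  sym_counting R U n w =
  (size (traj U n w))%:R^-1 *: \sum_(a <- traj U n w) F_sym R a.
Proof.
rewrite /traj size_map size_iota big_map /sym_counting.
by rewrite -[n in iota 0 n]subn0 big_mkord.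
Qed.

Section TailBound.
Variables (R : realType) (Omega : finType) (p : Omega -> Omega -> R).
Variables mu nu : Omega -> R.
Variables (disp : measure_display) (T : measurableType disp).
Variables (Pr : probability T R) (U : nat -> T -> sym_pair Omega).
Hypotheses (card2 : (2 <= #|Omega|)%N) (tp : is_transition p).
Hypotheses (dmu : is_distribution mu) (rev : is_reversible p mu).
Hypothesis mu_gt0 : forall u, 0 < mu u.
Hypotheses (dnu : is_distribution nu).
Hypothesis mU : is_markov_chain Pr (sym_init nu p) (sym_trans p) U.

Local Notation eta := (spectral_gap p mu).

Lemma frobenius_tail n t : 0 < t ->
  (Pr [set w | (t <= deviation p mu (traj U n.+1 w))%R] <=
   (ratio_sup nu mu *
    expR (1 - (tail_cst R)^-1 * eta * n.+1%:R * t ^+ 2))%R%:E)%E.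
Proof.
move=> t0; set x : R := _^-1 * _ * _ * _.
have /andP[eta0 _] := spectral_gap_bounds tp dmu rev mu_gt0 card2.
have rho1 := ratio_sup_ge1 dmu mu_gt0 dnu.
have rho0 : 0 <= ratio_sup nu mu := le_trans ler01 rho1.
have c0 := tail_cst_gt0 R.
have x0 : 0 <= x by rewrite /x mulr_ge0 ?sqr_ge0// mulr_ge0// mulr_ge0// invr_ge0 ltW.
have [t2|t2] := ltP 2 t.
  rewrite (_ : [set _ | _] = set0) ?measure0 ?lee_fin ?mulr_ge0 ?expR_ge0//.
  apply/seteqP; split=> w //= tw.
  have := lt_le_trans t2 tw.
  by rewrite ltNge (deviation_le2 tp dmu rev).
(* The moment order is the integer part of [x]; [m > x - 1] turns [expR (- m)] into [expR (1 - x)].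
   For [m = 0], which includes a vanishing gap, the claimed bound is at least 1. *)
have /andP[mx xm] := Num.Theory.truncn_itv x0; set m := Num.truncn x in mx xm.
have [m_eq0|m_gt0] := posnP m.
  apply: (@le_trans _ _ 1%E).
    apply: probability_le1.
    exact: (measurable_traj_pred mU n.+1 (fun s => t <= deviation p mu s)).
  rewrite lee_fin mulr_ege1// -[leLHS]expR0 ler_expR subr_ge0 ltW//.
  by move: xm; rewrite m_eq0.
have eta_gt0 : 0 < eta.
  rewrite lt_neqAle eta0 andbT; apply: contraTneq mx => eta_eq0.
  by rewrite -ltNge /x -eta_eq0 mulr0 !mul0r ltr0n.
apply: le_trans (prob_traj_le mU n (fun s => t <= deviation p mu s)) _.
rewrite lee_fin.
apply: (@le_trans _ _ (ratio_sup nu mu * expR (- m%:R))); last first.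
  by rewrite ler_wpM2l// ler_expR; move: xm; rewrite -natr1; lra.
apply: (@le_trans _ _ (ratio_sup nu mu *
    \sum_(s <- trajs (sym_pair Omega) n.+1 | t <= deviation p mu s)
      traj_weight (sym_init mu p) (sym_trans p) s)).
  by rewrite mulr_sumr; apply: ler_sum => s _; exact: weight_le_ratio.
rewrite ler_wpM2l//; apply: deviation_weight => //.
move: mx; rewrite /x => mx.
rewrite -ler_pdivlMl//; apply: le_trans mx _.
by rewrite !mulrA.
Qed.

End TailBound.

Theorem theorem1p2 (R : realType) :
  exists C1 C2 : R, 0 < C1 /\ 0 < C2 /\
  forall (Omega : finType) (p : Omega -> Omega -> R) (mu nu : Omega -> R)
    (disp : measure_display) (T : measurableType disp) (Pr : probability T R)
    (U : nat -> T -> sym_pair Omega),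
  (2 <= #|Omega|)%N ->
  is_transition p ->
  is_irreducible p ->
  is_distribution mu ->
  is_invariant p mu ->
  is_reversible p mu ->
  is_distribution nu ->
  is_markov_chain Pr (sym_init nu p) (sym_trans p) U ->
  forall (n : nat) (t : R), (0 < n)%N -> 0 < t ->
  (Pr [set w | (t <= opnorm (sym_counting R U n w - D_mx mu *m kernel_mx p))%R]
   <= (C1 * (#|Omega|%:R `^ (2 - pi / 4)) * ratio_sup nu mu
       * expR (- (C2 * spectral_gap p mu * n%:R * t ^+ 2)))%R%:E)%E.
Proof.
(* [expR 1] pays for rounding the moment order to an integer. *)
exists (expR 1), (tail_cst R)^-1; split; first exact: expR_gt0.
split; first by rewrite invr_gt0 tail_cst_gt0.
move=> Omega p mu nu disp T Pr U card2 tp irr dmu inv rev dnu mU [//|n] t _ t0.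
have mu_gt0 := invariant_gt0 tp dmu irr inv.
apply: le_trans; last first.
  apply: le_trans (frobenius_tail card2 tp dmu rev mu_gt0 dnu mU n t0) _.
  rewrite lee_fin expRD mulrCA mulrA [_ * _ * ratio_sup _ _]mulrAC.
  rewrite ler_wpM2r ?expR_ge0//; apply: ler_peMr.
    by rewrite mulr_ge0 ?expR_ge0// (le_trans ler01)// ratio_sup_ge1.
  (* The power of the dimension is at least 1, as [pi < 4] makes its exponent positive. *)
  rewrite -[leLHS](powRr0 #|Omega|%:R) ler_powR ?ler1n ?(ltnW card2)//.
  by have := @pihalf_lt2 R; lra.
(* Monotonicity of the measure needs measurable events; that of the operator norm is measurable as a
   predicate of the finite trajectory. *)
pose dev (Q : 'M[R]_#|Omega| -> R) (s : seq (sym_pair Omega)) :=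
  t <= Q ((size s)%:R^-1 *: \sum_(a <- s) F_sym R a - D_mx mu *m kernel_mx p).
apply: le_measure; rewrite ?inE.
- under eq_set do rewrite sym_counting_traj.
  exact: (measurable_traj_pred mU n.+1 (dev (@opnorm R _ _))).
- exact: (measurable_traj_pred mU n.+1 (fun s => t <= deviation p mu s)).
- move=> w /= tw; apply: le_trans tw _.
  by rewrite sym_counting_traj; exact: opnorm_le_fvec.
Qed.
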